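(* Let $k$ be a field of characteristic $p>0$ and let $H$ be a finite-dimensional pointed Hopf algebra over $k$ with $H\neq H_0$. Let $a\in G(H)$ be a skew point of $H$. Suppose there is an $x\in P_{a,1}\setminus H_0$ which is an eigenvector of the conjugation action of $a$ with eigenvalue $q$ (that is, $axa^{-1}=qx$), where $q\in k$ is a primitive $N$-th root of unity. Then: (1) If $x$ has degree $n$, then $n=Np^r$ for some $r\in\mathbb{N}$, $r\ge 0$, and $$x^n=\alpha_{-1}(a^n-1)+\sum_{i=0}^{r-1}\alpha_i x^{Np^i}$$ with $\alpha_i\in k$. In addition, if $0\le i\le r-1$ and $a^{N(p^r-p^i)}\neq 1$, then $\alpha_i=0$. (2) If $H$ is of rank one, then ($r=0$ and $N>1$) or ($r=1$ and $N=1$), for $r$ and $N$ as in (1). (3) Suppose that $H$ is of rank one with $N>1$ and $r=0$. Then $x$ is a common eigenvector for the conjugation action of the elements of $G(H)$, that is, $gxg^{-1}=\chi(g)x$ for all $g\in G(H)$, where $\chi:G(H)\to k^*$ is a linear character. (4) Suppose that $H$ is of rank one with $N=1$ and $r=1$. Then all elements of $P_{a,1}\setminus H_0$ are eigenvectors of the conjugation action of $a$ with eigenvalue $1$. If $\alpha_0=0$ (in the expression $x^p=\alpha_{-1}(a^p-1)+\alpha_0x$ of (1)) and $k$ is algebraically closed, then there exists an element $y\in P_{a,1}\setminus H_0$ with $y^p=0$. If in addition $a$ is not of order $p$, then $y$ is a common eigenvector of the conjugation action of $G(H)$. (5) Let $H$ be of rank one and generated by $H_1$ as an algebra, write $G=G(H)$,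 and let $A$ be the sub Hopf algebra of $H$ generated by $a$ and $x$. Then $A$ is a $kG$-module (algebra) via conjugation. Denote the smash product of $A$ and $kG$ by $A*kG$ (with the tensor product coalgebra structure). The map $A*kG\to H$, $h*g\mapsto hg$, is a surjective Hopf algebra homomorphism whose kernel is the ideal generated by $a*1-1*a$.
   Context: For a finite-dimensional Hopf algebra $H$ over $k$: $G(H)$ is the group of group-like elements; the coradical $H_0$ is the sum of the simple subcoalgebras; $H_1=\Delta^{-1}(H\otimes H_0+H_0\otimes H)$. $H$ is pointed if all simple subcoalgebras are one-dimensional, so that $H_0=kG(H)$. For $g,h\in G(H)$, $P_{g,h}=\{c\in H:\Delta(c)=c\otimes g+h\otimes c\}$. An element $a\in G(H)$ is a skew point if $P_{a,1}\setminus H_0\neq\emptyset$. A pointed $H$ has rank $t$ if $\dim_k k\otimes_{H_0}H_1=t+1$, where $k$ is the trivial $H_0$-module via the counit. The degree of $x\in H_1\setminus H_0$ is the smallest integer $n$ with $x^n\in\sum_{i=0}^{n-1}H_0x^i$. *)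

(* Defs.v *)
From HB Require Import structures.
From mathcomp Require Import all_boot all_order all_fingroup all_algebra.
From mathcomp Require Import falgebra.
From mathcomp Require Import boolp.

Set Implicit Arguments.
Unset Strict Implicit.
Unset Printing Implicit Defensive.
Set Warnings "-notation-overridden,-ambiguous-paths,-redundant-canonical-projection".

Import GRing.Theory.

Local Open Scope ring_scope.

Reserved Notation "u *t v" (at level 40, left associativity).

Section Span.
Variables (K : fieldType) (V : vectType K).

Lemma vspan_exists (P : V -> Prop) :
  exists U : {vspace V}, (forall v, P v -> v \in U) /\
    (forall W : {vspace V}, (forall v, P v -> v \in W) -> (U <= W)%VS).
Proof.
have [n] : exists n, exists U : {vspace V},
    (forall v, P v -> v \in U) /\ (\dim U < n)%N.
  by exists (\dim {:V}).+1; exists fullv; split=> // v _; rewrite memvf.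
elim: n => [[U []]//|n IHn [U [PU leUn]]].
have [sub|] := EM (forall W : {vspace V}, (forall v, P v -> v \in W) -> (U <= W)%VS).
  by exists U.
move=> /existsNP [W /not_implyP [PW /negP nUW]].
apply: IHn; exists (U :&: W)%VS; split=> [v Pv|].
  by rewrite memv_cap PU ?PW.
rewrite -ltnS; apply: leq_trans leUn; rewrite ltnS ltn_neqAle dimvS ?capvSl // andbT.
apply: contra nUW => /eqP eqd; apply/capv_idPl/eqP.
by rewrite eqEdim capvSl eqd leqnn.
Qed.

(* The linear span of an arbitrary, possibly infinite, set of vectors. *)
Definition vspan (P : V -> Prop) : {vspace V} := projT1 (cid (vspan_exists P)).

Lemma mem_vspan (P : V -> Prop) v : P v -> v \in vspan P.
Proof. by rewrite /vspan; case: cid => U /= [PU _]; apply: PU. Qed.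

Lemma vspan_sub (P : V -> Prop) (W : {vspace V}) :
  (forall v, P v -> v \in W) -> (vspan P <= W)%VS.
Proof. by rewrite /vspan; case: cid => U /= [_]; apply. Qed.

End Span.

Section Tensor.
Variable K : fieldType.
Implicit Types U V W X : vectType K.

(* The tensor product of U and V, in coordinates: t i j is the coefficient of *)
(* t at the tensor of the i-th and j-th vectors of fixed bases of U and V.    *)
Definition tensor U V := 'M[K]_(\dim {:U}, \dim {:V}).
HB.instance Definition _ U V := Vector.on (tensor U V).

Definition tpure U V (u : U) (v : V) : tensor U V :=
  \matrix_(i, j) (coord (vbasis fullv) i u * coord (vbasis fullv) j v).

Local Notation "u *t v" := (tpure u v).

(* The linear map U (x) V -> W induced by a bilinear map f : U x V -> W. For  *)
(* t = comul c, tlift (fun c1 c2 => f c1 c2) t is the Sweedler sum of the     *)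
(* f c_(1) c_(2). Only meaningful for bilinear f.                             *)
Definition tlift U V W (f : U -> V -> W) (t : tensor U V) : W :=
  \sum_i \sum_j t i j *: f (vbasis fullv)`_i (vbasis fullv)`_j.

Lemma tlift_is_linear U V W (f : U -> V -> W) : linear (tlift f).
Proof.
move=> c s t; rewrite /tlift scaler_sumr -big_split; apply: eq_bigr => i _ /=.
rewrite scaler_sumr -big_split; apply: eq_bigr => j _ /=.
by rewrite !mxE scalerDl scalerA.
Qed.
HB.instance Definition _ U V W (f : U -> V -> W) :=
  GRing.isLinear.Build K (tensor U V) W _ (tlift f) (@tlift_is_linear U V W f).

Definition bilin U V W (f : U -> V -> W) :=
  (forall v, linear (f^~ v)) /\ (forall u, linear (f u)).

Lemma bilin_tpure U V : bilin (@tpure U V).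
Proof.
split=> w c u v; apply/matrixP=> i j; rewrite !mxE linearP /=.
  by rewrite mulrDl mulrA.
by rewrite mulrDr mulrCA.
Qed.

Lemma bilin_suml U V W (f : U -> V -> W) (I : Type) (r : seq I) (P : pred I) (F : I -> U) v :
  bilin f -> f (\sum_(i <- r | P i) F i) v = \sum_(i <- r | P i) f (F i) v.
Proof.
case=> fl _; pose g := HB.pack_for {linear U -> W} (f^~ v) (GRing.isLinear.Build K U W _ (f^~ v) (fl v)).
exact: (linear_sum g).
Qed.

Lemma bilin_sumr U V W (f : U -> V -> W) (I : Type) (r : seq I) (P : pred I) (F : I -> V) u :
  bilin f -> f u (\sum_(i <- r | P i) F i) = \sum_(i <- r | P i) f u (F i).
Proof.
case=> _ fr; pose g := HB.pack_for {linear V -> W} (f u) (GRing.isLinear.Build K V W _ (f u) (fr u)).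
exact: (linear_sum g).
Qed.

Lemma bilinZl U V W (f : U -> V -> W) c u v : bilin f -> f (c *: u) v = c *: f u v.
Proof.
case=> fl _; pose g := HB.pack_for {linear U -> W} (f^~ v) (GRing.isLinear.Build K U W _ (f^~ v) (fl v)).
exact: (linearZZ g).
Qed.

Lemma bilinZr U V W (f : U -> V -> W) c u v : bilin f -> f u (c *: v) = c *: f u v.
Proof.
case=> _ fr; pose g := HB.pack_for {linear V -> W} (f u) (GRing.isLinear.Build K V W _ (f u) (fr u)).
exact: (linearZZ g).
Qed.

Lemma tliftE U V W (f : U -> V -> W) u v : bilin f -> tlift f (u *t v) = f u v.
Proof.
move=> bf; rewrite [in RHS](coord_vbasis (memvf u)) (bilin_suml _ _ _ _ bf).
apply: eq_bigr => i _; rewrite (bilinZl _ _ _ bf).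
rewrite [in RHS](coord_vbasis (memvf v)) (bilin_sumr _ _ _ _ bf) scaler_sumr.
by apply: eq_bigr => j _; rewrite (bilinZr _ _ _ bf) scalerA !mxE.
Qed.

Lemma tensor_ext U V W (f g : {linear tensor U V -> W}) :
  (forall u v, f (u *t v) = g (u *t v)) -> f =1 g.
Proof.
move=> fg t.
have -> : t = tlift (@tpure U V) t.
  apply/matrixP=> i j; rewrite /tlift summxE (bigD1 i) //= summxE (bigD1 j) //=.
  rewrite !mxE !coord_free ?(basis_free (vbasisP _)) // !eqxx !mulr1.
  rewrite big1 => [|j' nj]; last first.
    rewrite !mxE !coord_free ?(basis_free (vbasisP _)) // !eqxx mul1r.
    by rewrite (negbTE nj) mulr0.
  rewrite big1 ?addr0 // => i' ni; rewrite summxE big1 // => j' _.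
  rewrite !mxE !coord_free ?(basis_free (vbasisP _)) //.
  by rewrite (negbTE ni) mul0r mulr0.
rewrite /tlift !linear_sum; apply: eq_bigr => i _.
rewrite !linear_sum; apply: eq_bigr => j _.
by rewrite !linearZ /= fg.
Qed.

Lemma linear_tlift U V W X (h : {linear W -> X}) (f : U -> V -> W) t :
  h (tlift f t) = tlift (fun u v => h (f u v)) t.
Proof.
rewrite /tlift linear_sum; apply: eq_bigr => i _.
by rewrite linear_sum; apply: eq_bigr => j _; rewrite linearZ.
Qed.

Lemma eq_tlift U V W (f g : U -> V -> W) t : f =2 g -> tlift f t = tlift g t.
Proof.
by move=> fg; apply: eq_bigr => i _; apply: eq_bigr => j _; rewrite fg.
Qed.

(* f (x) g *)
Definition tmap U V U' V' (f : U -> U') (g : V -> V') (t : tensor U V) :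
  tensor U' V' := tlift (fun u v => f u *t g v) t.

(* A (x) B inside U (x) V *)
Definition tensorv U V (A : {vspace U}) (B : {vspace V}) : {vspace tensor U V} :=
  vspan (fun t => exists u v, [/\ u \in A, v \in B & t = u *t v]).

End Tensor.

Notation "u *t v" := (tpure u v) : ring_scope.

(* The product (a (x) b) (c (x) d) = ac (x) bd of A (x) A. *)
Definition tmul (K : fieldType) (A : falgType K) (s t : tensor A A) : tensor A A :=
  tlift (fun a b => tlift (fun c d => (a * c) *t (b * d)) t) s.

Section TensorTheory.
Variable K : fieldType.
Implicit Types U V W X : vectType K.

Lemma bilin_comp U V U' V' W (f : U' -> V' -> W) (g : U -> U') (h : V -> V') :
  bilin f -> linear g -> linear h -> bilin (fun u v => f (g u) (h v)).
Proof. by case=> fl fr lg lh; split=> w c u v; rewrite ?lg ?lh ?fl ?fr. Qed.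

Lemma bilin_post U V W X (f : U -> V -> W) (h : W -> X) :
  bilin f -> linear h -> bilin (fun u v => h (f u v)).
Proof. by case=> fl fr lh; split=> w c u v; rewrite ?fl ?fr lh. Qed.

Lemma bilin_tlift U V U' V' W (F : U -> V -> U' -> V' -> W) t :
  (forall c d, bilin (fun a b => F a b c d)) ->
  bilin (fun a b => tlift (F a b) t).
Proof.
move=> bF; split=> w c u v; rewrite /tlift scaler_sumr -big_split;
  apply: eq_bigr => i _; rewrite /= scaler_sumr -big_split;
  apply: eq_bigr => j _; have [fl fr] := bF (vbasis fullv)`_i (vbasis fullv)`_j.
- by rewrite fl /= scalerDr !scalerA mulrC.
- by rewrite fr /= scalerDr !scalerA mulrC.
Qed.

Lemma bilin_mul (A : falgType K) : bilin (fun a b : A => a * b).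
Proof.
by split=> w c u v; [rewrite mulrDl scalerAl | rewrite mulrDr scalerAr].
Qed.

Lemma id_is_linear U : linear (fun u : U => u).
Proof. by []. Qed.

Lemma comp_is_linear U V W (f : V -> W) (g : U -> V) :
  linear f -> linear g -> linear (fun u => f (g u)).
Proof. by move=> lf lg c u v; rewrite lg lf. Qed.

Lemma tpure_linearl U V (v : V) : linear (fun u : U => u *t v).
Proof. exact: (bilin_tpure U V).1. Qed.

Lemma tpure_linearr U V (u : U) : linear (fun v : V => u *t v).
Proof. exact: (bilin_tpure U V).2. Qed.

Lemma tmap_is_linear U V U' V' (f : U -> U') (g : V -> V') :
  linear (tmap f g).
Proof. exact: tlift_is_linear. Qed.

Lemma tmapE U V U' V' (f : U -> U') (g : V -> V') u v :
  linear f -> linear g -> tmap f g (u *t v) = f u *t g v.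
Proof.
by move=> lf lg; rewrite /tmap tliftE //; exact: (bilin_comp (bilin_tpure _ _) lf lg).
Qed.

Lemma tlift_tlift U V U' V' W (F : U' -> V' -> W) (P : U -> V -> tensor U' V') t :
  tlift F (tlift P t) = tlift (fun a b => tlift F (P a b)) t.
Proof. exact: linear_tlift. Qed.

Lemma tlift_tmap U V U' V' W (F : U' -> V' -> W) (f : U -> U') (g : V -> V') t :
  bilin F -> tlift F (tmap f g t) = tlift (fun a b => F (f a) (g b)) t.
Proof.
by move=> bF; rewrite /tmap tlift_tlift; apply: eq_tlift => a b; rewrite tliftE.
Qed.

Lemma fun_tlift U V W X (h : W -> X) (f : U -> V -> W) t : linear h ->
  h (tlift f t) = tlift (fun u v => h (f u v)) t.
Proof.
move=> lh.
pose h' := HB.pack_for {linear W -> X} h (GRing.isLinear.Build K W X _ h lh).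
exact: (linear_tlift h').
Qed.

Lemma lin_sum U V (h : U -> V) (I : Type) (r : seq I) (P : pred I) (F : I -> U) :
  linear h -> h (\sum_(i <- r | P i) F i) = \sum_(i <- r | P i) h (F i).
Proof.
move=> lh.
pose h' := HB.pack_for {linear U -> V} h (GRing.isLinear.Build K U V _ h lh).
exact: (linear_sum h').
Qed.

Lemma lin0 U V (h : U -> V) : linear h -> h 0 = 0.
Proof. by move=> lh; have := lh (-1) 0 0; rewrite scaler0 addr0 scaleN1r addNr. Qed.

Lemma linZ U V (h : U -> V) c u : linear h -> h (c *: u) = c *: h u.
Proof. by move=> lh; have := lh c u 0; rewrite (lin0 lh) !addr0. Qed.

Lemma linD U V (h : U -> V) : linear h -> {morph h : u v / u + v}.
Proof. by move=> lh u v; have := lh 1 u v; rewrite !scale1r. Qed.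

Lemma tensor_extP U V W (f g : tensor U V -> W) : linear f -> linear g ->
  (forall u v, f (u *t v) = g (u *t v)) -> f =1 g.
Proof.
move=> lf lg.
pose f' := HB.pack_for {linear tensor U V -> W} f (GRing.isLinear.Build K _ W _ f lf).
pose g' := HB.pack_for {linear tensor U V -> W} g (GRing.isLinear.Build K _ W _ g lg).
exact: (@tensor_ext _ _ _ _ f' g').
Qed.

Lemma tlift_pure U V (t : tensor U V) : tlift (@tpure K U V) t = t.
Proof.
move: t; apply: tensor_extP => [||u v].
- exact: tlift_is_linear.
- exact: id_is_linear.
by rewrite tliftE //; apply: bilin_tpure.
Qed.

Lemma mem_tensorv U V (A : {vspace U}) (B : {vspace V}) u v :
  u \in A -> v \in B -> u *t v \in tensorv A B.
Proof. by move=> Au Bv; apply: mem_vspan; exists u, v. Qed.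

Lemma tensorv_ind U V W (A : {vspace U}) (B : {vspace V}) (f g : tensor U V -> W) :
  linear f -> linear g ->
  (forall u v, u \in A -> v \in B -> f (u *t v) = g (u *t v)) ->
  {in tensorv A B, f =1 g}.
Proof.
move=> lf lg fg t At; apply/eqP; rewrite -subr_eq0; apply/eqP.
have lh : linear (fun s => f s - g s).
  by move=> c u v; rewrite lf lg scalerBr opprD addrACA.
pose h := HB.pack_for {linear tensor U V -> W} (fun s => f s - g s)
  (GRing.isLinear.Build K _ W _ (fun s => f s - g s) lh).
suff sub : (tensorv A B <= lker (linfun h))%VS.
  by have := subvP sub _ At; rewrite memv_ker lfunE => /eqP.
apply: vspan_sub => _ [u [v [Au Bv ->]]].
by rewrite memv_ker lfunE /= fg // subrr.
Qed.

Lemma mem_tlift U V W (f : U -> V -> W) (B : {vspace W}) t :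
  (forall u v, f u v \in B) -> tlift f t \in B.
Proof.
by move=> fB; apply: rpred_sum => i _; apply: rpred_sum => j _; apply: rpredZ.
Qed.

Lemma tensorv_map U V U' V' (A : {vspace U'}) (B : {vspace V'})
    (f : U -> U') (g : V -> V') t :
  (forall u, f u \in A) -> (forall v, g v \in B) -> tmap f g t \in tensorv A B.
Proof. by move=> fA gB; apply: mem_tlift => u v; apply: mem_tensorv. Qed.

Lemma tmul_pure (A : falgType K) (a b c d : A) :
  tmul (a *t b) (c *t d) = (a * c) *t (b * d).
Proof.
rewrite /tmul tliftE; last first.
  by apply: bilin_tlift => c' d'; apply: bilin_comp (bilin_tpure _ _) _ _ => k u v;
     rewrite mulrDl scalerAl.
rewrite tliftE //.
by apply: bilin_comp (bilin_tpure _ _) _ _ => k u v; rewrite mulrDr scalerAr.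
Qed.

Lemma tmul_linearl (A : falgType K) (t : tensor A A) : linear (fun s => tmul s t).
Proof. exact: tlift_is_linear. Qed.

Lemma linear_param U V W X (F : U -> V -> X -> W) (s : tensor U V) :
  (forall a b, linear (F a b)) -> linear (fun x => tlift (fun a b => F a b x) s).
Proof.
move=> lF c u v; rewrite /tlift scaler_sumr -big_split; apply: eq_bigr => i _ /=.
rewrite scaler_sumr -big_split; apply: eq_bigr => j _ /=.
by rewrite lF scalerDr !scalerA mulrC.
Qed.

Lemma bilin_sweedler U V W X (Y : vectType K) (F : X -> U -> V -> W) (L : Y -> tensor U V) :
  linear L -> (forall a b, linear (fun x => F x a b)) ->
  bilin (fun x y => tlift (F x) (L y)).
Proof.
move=> lL lF; split=> [y|x].
  exact: (@linear_param _ _ _ _ (fun a b x => F x a b)).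
exact: comp_is_linear (tlift_is_linear _) lL.
Qed.

Lemma tmul_linearr (A : falgType K) (s : tensor A A) : linear (tmul s).
Proof.
exact: (@linear_param _ _ _ _
  (fun a b t => tlift (fun c d => (a * c) *t (b * d)) t) s
  (fun a b => tlift_is_linear _)).
Qed.

Lemma tmul_tmap (A B : falgType K) (f g : A -> B) s t :
  linear f -> {morph f : x y / x * y} -> linear g -> {morph g : x y / x * y} ->
  tmap f g (tmul s t) = tmul (tmap f g s) (tmap f g t).
Proof.
move=> lf mf lg mg; move: s.
apply: tensor_extP => [||a b].
- by apply: comp_is_linear (tmul_linearl _); apply: tmap_is_linear.
- by apply: (comp_is_linear (f := fun s => tmul s _)) (tmap_is_linear _ _); apply: tmul_linearl.
move: t; apply: tensor_extP => [||c d].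
- by apply: comp_is_linear (tmul_linearr _); apply: tmap_is_linear.
- by apply: comp_is_linear (tmap_is_linear _ _); apply: tmul_linearr.
by rewrite tmul_pure !tmapE // tmul_pure mf mg.
Qed.

End TensorTheory.

HB.mixin Record Falgebra_isHopf (K : fieldType) H of Falgebra K H := {
  comul : H -> tensor H H;
  counit : H -> K;
  antipode : H -> H;
  comul_is_linear : linear comul;
  counit_is_scalar : scalar counit;
  antipode_is_linear : linear antipode;
  (* sum c_(1) (x) c_(2) (x) c_(3), bracketed to the left *)
  comulA : forall c,
    tlift (fun c1 c2 => comul c1 *t c2) (comul c) =
    tlift (fun c1 c2 => tlift (fun d1 d2 => (c1 *t d1) *t d2) (comul c2))
      (comul c);
  counitl : forall c, tlift (fun c1 c2 => counit c1 *: c2) (comul c) = c;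
  counitr : forall c, tlift (fun c1 c2 => counit c2 *: c1) (comul c) = c;
  comul1 : comul 1 = 1 *t 1;
  comulM : {morph comul : x y / x * y >-> tmul x y};
  counit1 : counit 1 = 1;
  counitM : {morph counit : x y / x * y};
  antipodel : forall c,
    tlift (fun c1 c2 => antipode c1 * c2) (comul c) = counit c *: 1;
  antipoder : forall c,
    tlift (fun c1 c2 => c1 * antipode c2) (comul c) = counit c *: 1
}.

#[short(type="hopfType")]
HB.structure Definition Hopf (K : fieldType) :=
  { H of Falgebra_isHopf K H & Falgebra K H }.

Section HopfTheory.
Variables (K : fieldType) (H : hopfType K).
Implicit Types (g h c x : H) (A C D : {vspace H}).

HB.instance Definition _ :=
  GRing.isLinear.Build K H (tensor H H) _ (@comul K H) (@comul_is_linear K H).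
HB.instance Definition _ :=
  GRing.isLinear.Build K H K _ (@counit K H) (@counit_is_scalar K H).
HB.instance Definition _ :=
  GRing.isLinear.Build K H H _ (@antipode K H) (@antipode_is_linear K H).

Definition is_grouplike g := (comul g == g *t g) && (counit g == 1).

Record grouplike := Grouplike { glval :> H; _ : is_grouplike glval }.
HB.instance Definition _ := [isSub for glval].
HB.instance Definition _ := [Choice of grouplike by <:].

Lemma glvalP (g : grouplike) : comul (glval g) = glval g *t glval g /\ counit (glval g) = 1.
Proof. by case: g => g /= /andP[/eqP -> /eqP ->]. Qed.

Lemma is_grouplike1 : is_grouplike 1.
Proof. by rewrite /is_grouplike comul1 counit1 !eqxx. Qed.

Lemma is_grouplikeM (g h : grouplike) : is_grouplike (glval g * glval h).
Proof.
have [Dg eg] := glvalP g; have [Dh eh] := glvalP h.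
by rewrite /is_grouplike comulM counitM Dg Dh eg eh tmul_pure mulr1 !eqxx.
Qed.

Lemma antipode_bilinl : bilin (fun c1 c2 => antipode c1 * c2 : H).
Proof. by apply: (bilin_comp (bilin_mul H)) => //; exact: antipode_is_linear. Qed.

Lemma antipode_bilinr : bilin (fun c1 c2 => c1 * antipode c2 : H).
Proof. by apply: (bilin_comp (bilin_mul H)) => //; exact: antipode_is_linear. Qed.

Lemma antipode_mulVg (g : grouplike) : antipode (glval g) * glval g = 1.
Proof.
have := antipodel (glval g); have [-> ->] := glvalP g.
by rewrite scale1r tliftE //; apply: antipode_bilinl.
Qed.

Lemma antipode_mulgV (g : grouplike) : glval g * antipode (glval g) = 1.
Proof.
have := antipoder (glval g); have [-> ->] := glvalP g.
by rewrite scale1r tliftE //; apply: antipode_bilinr.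
Qed.

Lemma is_grouplikeV (g : grouplike) : is_grouplike (antipode (glval g)).
Proof.
have [Dg eg] := glvalP g; rewrite /is_grouplike.
set s := antipode _.
have sg : s * glval g = 1 by apply: antipode_mulVg.
have gs : glval g * s = 1 by apply: antipode_mulgV.
have mulA (t : tensor H H) a b c d :
    tmul (tmul t (a *t b)) (c *t d) = tmul t ((a * c) *t (b * d)).
  move: t; apply: tensor_extP => [||u v].
  - by apply: (comp_is_linear (f := fun t => tmul t _)); exact: tmul_linearl.
  - exact: tmul_linearl.
  - by rewrite !tmul_pure !mulrA.
have mul1 (t : tensor H H) : tmul t (1 *t 1) = t.
  move: t; apply: tensor_extP => [||u v].
  - exact: tmul_linearl.
  - exact: id_is_linear.
  - by rewrite tmul_pure !mulr1.
have -> : counit s = 1.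
  by rewrite -[LHS]mulr1 -eg -counitM sg counit1.
rewrite eqxx andbT.
have <- : tmul (1 *t 1) (s *t s) = s *t s by rewrite tmul_pure !mul1r.
by rewrite -comul1 -sg comulM Dg mulA gs mul1.
Qed.

Lemma grouplike_free (s : seq grouplike) : uniq s -> free (map glval s).
Proof.
elim: s => [|g s IHs] /=; first by rewrite nil_free.
case/andP=> gs us; rewrite free_cons IHs // andbT.
apply/negP; pose X := in_tuple (map glval s).
move=> /(@coord_span _ _ _ X) gE.
have fX : free X := IHs us.
have [Dg eg] := glvalP g.
have XP (i : 'I_(size (map glval s))) : exists2 h : grouplike, X`_i = glval h & h \in s.
  have /mapP[h hs e] : X`_i \in map glval s by apply: mem_nth.
  by exists h.
suff c0 i : coord X i (glval g) = 0.
  have g0 : glval g = 0.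
    by rewrite gE big1 // => i _; rewrite c0 scale0r.
  by have := eg; rewrite g0 linear0 => /eqP; rewrite eq_sym oner_eq0.
have bc : bilin (fun a b : H => coord X i a *: b).
  by split=> w c u v; rewrite linearP /= ?scalerDl ?scalerDr ?scalerA // mulrC.
have /eqP := congr1 (tlift (fun a b : H => coord X i a *: b)) Dg.
rewrite tliftE // {1}gE linear_sum linear_sum /= (bigD1 i) //= big1 => [|j nj].
  rewrite addr0 !linearZZ /=; case: (XP i) => h /= Xh hs.
  rewrite Xh (glvalP h).1 tliftE // -Xh -[_`_i]/(X`_i).
  rewrite coord_free // eqxx scale1r -subr_eq0 -scalerBr scaler_eq0.
  case/orP=> [/eqP //|]; rewrite subr_eq0 => /eqP e.
  case/negP: gs; suff -> : g = h by [].
  by apply: val_inj; exact: (etrans (esym e) Xh).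
rewrite !linearZZ /=; case: (XP j) => h /= Xh hs.
rewrite Xh (glvalP h).1 tliftE // -Xh -[_`_j]/(X`_j).
by rewrite coord_free // (negbTE nj) scale0r scaler0.
Qed.

Lemma grouplike_enum_exists :
  exists s : seq grouplike, uniq s /\ forall g : grouplike, g \in s.
Proof.
have [n] : exists n, exists s : seq grouplike, uniq s /\ (\dim {:H} < n + size s)%N.
  by exists (\dim {:H}).+1, [::]; rewrite addn0.
elim: n => [[s [us]]|n IHn [s [us lts]]].
  have := grouplike_free us; rewrite /free size_map => /eqP sz.
  by rewrite add0n -sz ltnNge dimvS ?subvf.
have [sP|/existsNP [g /negP gs]] := EM (forall g : grouplike, g \in s); first by exists s.
by apply: IHn; exists (g :: s); rewrite /= gs us addnS.
Qed.

Definition grouplike_enum := projT1 (cid grouplike_enum_exists).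

Lemma grouplike_enumP : finite_axiom grouplike_enum.
Proof.
rewrite /grouplike_enum; case: cid => s /= [us sP] g.
by rewrite count_uniq_mem // sP.
Qed.

Lemma grouplike_enumK :
  pcancel (fun g : grouplike => index g grouplike_enum)
          (fun n => nth None (map some grouplike_enum) n).
Proof.
move=> g; have gs : g \in grouplike_enum.
  by rewrite -has_pred1 has_count grouplike_enumP.
by rewrite (nth_map g) ?index_mem // nth_index.
Qed.

HB.instance Definition _ := PCanIsCountable grouplike_enumK.
HB.instance Definition _ := isFinite.Build grouplike grouplike_enumP.

Definition grouplike_one := Grouplike is_grouplike1.
Definition grouplike_mul (g h : grouplike) := Grouplike (is_grouplikeM g h).
Definition grouplike_inv (g : grouplike) := Grouplike (is_grouplikeV g).

Lemma grouplike_mulA : associative grouplike_mul.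
Proof. by move=> f g h; apply/val_inj; rewrite /= mulrA. Qed.
Lemma grouplike_mul1g : left_id grouplike_one grouplike_mul.
Proof. by move=> g; apply/val_inj; rewrite /= mul1r. Qed.
Lemma grouplike_mulg1 : right_id grouplike_one grouplike_mul.
Proof. by move=> g; apply/val_inj; rewrite /= mulr1. Qed.
Lemma grouplike_mulVg : left_inverse grouplike_one grouplike_inv grouplike_mul.
Proof. by move=> g; apply/val_inj; rewrite /= antipode_mulVg. Qed.
Lemma grouplike_mulgV : right_inverse grouplike_one grouplike_inv grouplike_mul.
Proof. by move=> g; apply/val_inj; rewrite /= antipode_mulgV. Qed.

HB.instance Definition _ := isGroup.Build grouplike
  grouplike_mulA grouplike_mul1g grouplike_mulg1 grouplike_mulVg grouplike_mulgV.

End HopfTheory.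

Section Pointed.
Variables (K : fieldType) (H : hopfType K).
Implicit Types (g h c x y : H) (C D : {vspace H}).

Definition subcoalgebra C := forall c, c \in C -> comul c \in tensorv C C.

Definition simple_subcoalgebra C :=
  [/\ subcoalgebra C, C <> 0%VS &
      forall D, subcoalgebra D -> (D <= C)%VS -> D = 0%VS \/ D = C].

(* H_0, the sum of the simple subcoalgebras *)
Definition coradical : {vspace H} :=
  vspan (fun c => exists2 C, simple_subcoalgebra C & c \in C).

(* H_1, the preimage under comul of H (x) H_0 + H_0 (x) H *)
Definition coradical1 : {vspace H} :=
  (linfun (@comul K H) @^-1: (tensorv fullv coradical + tensorv coradical fullv))%VS.

Definition pointed := forall C, simple_subcoalgebra C -> \dim C = 1%N.

(* P_{g,h}; meant for group-like g and h *)
Definition skew_primitive g h : {pred H} :=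
  [pred c | comul c == c *t g + h *t c].

Definition skew_point (a : grouplike H) :=
  exists2 c, c \in skew_primitive (glval a) 1 & c \notin coradical.

(* The tensor product over H_0 of k (with h acting on k as counit h) and H_1  *)
(* is the quotient of k (x) H_1 by the span of the balancing relations; the   *)
(* dimension of a quotient U / R is that of a complement U :\: R of R in U.   *)
Definition balancing : {vspace tensor K^o H} :=
  vspan (fun t => exists (c : K) (h m : H), [/\ h \in coradical, m \in coradical1 &
    t = (c * counit h : K^o) *t m - (c : K^o) *t (h * m)]).

Definition has_rank (t : nat) :=
  \dim (tensorv (fullv : {vspace K^o}) coradical1 :\: balancing) = t.+1.

Definition below_degree (n : nat) x : {vspace H} :=
  (\sum_(i < n) coradical * <[x ^+ i]>)%VS.

Definition has_degree x (n : nat) :=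
  x ^+ n \in below_degree n x /\
  forall m, (m < n)%N -> x ^+ m \notin below_degree m x.

Definition conj_by (g : grouplike H) x := glval g * x * (glval g)^-1.

Definition common_conj_eigenvector x :=
  x != 0 /\ forall g : grouplike H, exists c : K, conj_by g x = c *: x.

End Pointed.

Section SubHopf.

Variables (K : fieldType) (H : hopfType K).

Definition is_subhopf (A : {vspace H}) : Prop :=
  [/\ 1 \in A,
      {in A &, forall x y, x * y \in A},
      {in A, forall x, comul x \in tensorv A A} &
      {in A, forall x, antipode x \in A}].

Record subHopf := SubHopf { subhopf_vspace :> {vspace H};
                            subhopfP : is_subhopf subhopf_vspace }.

Fact subhopf_is_aspace (A : subHopf) : is_aspace A.
Proof.
case: (subhopfP A) => A1 AM _ _; rewrite /is_aspace has_algid1 //=.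
by apply/prodvP=> x y Ax Ay; apply: AM.
Qed.

Definition subhopf_aspace (A : subHopf) : {aspace H} :=
  ASpace (subhopf_is_aspace A).

Section SubHopfType.
Variable A : subHopf.

Definition subhopf_of := subvs_of (subhopf_aspace A).
HB.instance Definition _ := Falgebra.on subhopf_of.

Definition subhopf_val (u : subhopf_of) : H := vsval u.
Definition subhopf_proj (x : H) : subhopf_of := vsproj (subhopf_aspace A) x.

Definition subhopf_comul (u : subhopf_of) : tensor subhopf_of subhopf_of :=
  tmap subhopf_proj subhopf_proj (comul (subhopf_val u)).
Definition subhopf_counit (u : subhopf_of) : K := counit (subhopf_val u).
Definition subhopf_antipode (u : subhopf_of) : subhopf_of :=
  subhopf_proj (antipode (subhopf_val u)).

Local Notation ev := subhopf_val.
Local Notation pr := subhopf_proj.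

Lemma subhopf_val_linear : linear subhopf_val. Proof. exact: linearP. Qed.
Lemma subhopf_proj_linear : linear subhopf_proj. Proof. exact: linearP. Qed.
Hint Resolve subhopf_val_linear subhopf_proj_linear : core.

Lemma subhopf_valK : cancel subhopf_val subhopf_proj.
Proof. exact: vsvalK. Qed.
Lemma subhopf_projK x : x \in subhopf_vspace A -> subhopf_val (subhopf_proj x) = x.
Proof. exact: vsprojK. Qed.
Lemma subhopf_valP u : subhopf_val u \in subhopf_vspace A.
Proof. exact: subvsP. Qed.
Lemma subhopf_val_inj : injective subhopf_val.
Proof. exact: can_inj subhopf_valK. Qed.

Lemma subhopf_val1 : subhopf_val 1 = 1.
Proof. by case: (subhopfP A) => A1 _ _ _; apply/eqP; rewrite -/(algid (subhopf_aspace A)) algid_eq1. Qed.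
Lemma subhopf_valZ c u : subhopf_val (c *: u) = c *: subhopf_val u.
Proof. by []. Qed.
Lemma subhopf_valM : {morph subhopf_val : u v / u * v}.
Proof. by []. Qed.

Lemma subhopf_comulE u : tmap ev ev (subhopf_comul u) = comul (ev u).
Proof.
case: (subhopfP A) => _ _ /(_ _ (subhopf_valP u)) AD _.
rewrite /subhopf_comul; move: (comul _) AD.
apply: tensorv_ind => [||x y Ax Ay].
- by apply: comp_is_linear; apply: tmap_is_linear.
- exact: id_is_linear.
- by rewrite !tmapE // !subhopf_projK.
Qed.

Lemma subhopf_antipodeE u : ev (subhopf_antipode u) = antipode (ev u).
Proof.
case: (subhopfP A) => _ _ _ /(_ _ (subhopf_valP u)) AS.
exact: subhopf_projK.
Qed.

Lemma tmap_ev_inj : injective (tmap ev ev).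
Proof.
apply: (can_inj (g := tmap pr pr)); move=> t; move: t.
apply: tensor_extP => [||u v].
- by apply: comp_is_linear; apply: tmap_is_linear.
- exact: id_is_linear.
- by rewrite !tmapE // !subhopf_valK.
Qed.

Lemma tmap3_ev_inj : injective (tmap (tmap ev ev) ev).
Proof.
apply: (can_inj (g := tmap (tmap pr pr) pr)); move=> t; move: t.
have lpp : linear (tmap pr pr) by apply: tmap_is_linear.
have lvv : linear (tmap ev ev) by apply: tmap_is_linear.
apply: tensor_extP => [||s u].
- by apply: comp_is_linear; apply: tmap_is_linear.
- exact: id_is_linear.
rewrite !tmapE // subhopf_valK; congr (_ *t _); move: s.
apply: tensor_extP => [||u' v'].
- exact: comp_is_linear.
- exact: id_is_linear.
- by rewrite !tmapE // !subhopf_valK.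
Qed.

Lemma subhopf_comul_linear : linear subhopf_comul.
Proof.
apply: comp_is_linear; first exact: tmap_is_linear.
by apply: comp_is_linear => //; apply: comul_is_linear.
Qed.
Lemma subhopf_counit_scalar : scalar subhopf_counit.
Proof. by move=> c u v; rewrite /subhopf_counit subhopf_val_linear counit_is_scalar. Qed.
Lemma subhopf_antipode_linear : linear subhopf_antipode.
Proof.
apply: comp_is_linear => //; apply: comp_is_linear => //; exact: antipode_is_linear.
Qed.

Lemma subhopf_comulA c :
  tlift (fun c1 c2 => subhopf_comul c1 *t c2) (subhopf_comul c) =
  tlift (fun c1 c2 => tlift (fun d1 d2 => (c1 *t d1) *t d2) (subhopf_comul c2))
      (subhopf_comul c).
Proof.
apply: tmap3_ev_inj.
have lvv : linear (tmap ev ev) by apply: tmap_is_linear.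
rewrite !(fun_tlift _ _ (tmap_is_linear _ _)).
under eq_tlift => c1 c2 do rewrite tmapE // subhopf_comulE.
rewrite -(tlift_tmap (F := fun d1 d2 : H => comul d1 *t d2)); last first.
  by apply: bilin_comp (bilin_tpure _ _) _ _ => //; apply: comul_is_linear.
rewrite subhopf_comulE comulA -subhopf_comulE tlift_tmap; last first.
  apply: bilin_sweedler => [|d1 d2]; first exact: comul_is_linear.
  by apply: (comp_is_linear (tpure_linearl d2)) (tpure_linearl d1).
apply: eq_tlift => c1 c2; rewrite -subhopf_comulE tlift_tmap; last first.
  by apply: bilin_comp (bilin_tpure _ _) _ _ => //; apply: tpure_linearr.
rewrite (fun_tlift _ _ (tmap_is_linear _ _)); apply: eq_tlift => d1 d2.
by rewrite !tmapE.
Qed.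

Lemma subhopf_counitl c :
  tlift (fun c1 c2 => subhopf_counit c1 *: c2) (subhopf_comul c) = c.
Proof.
apply: subhopf_val_inj; rewrite (fun_tlift _ _ subhopf_val_linear).
have bs : bilin (fun c1 c2 : H => counit c1 *: c2).
  split=> w k u v; first by rewrite counit_is_scalar scalerDl scalerA.
  by rewrite scalerDr !scalerA mulrC.
by rewrite -[RHS]counitl -subhopf_comulE [RHS]tlift_tmap.
Qed.

Lemma subhopf_counitr c :
  tlift (fun c1 c2 => subhopf_counit c2 *: c1) (subhopf_comul c) = c.
Proof.
apply: subhopf_val_inj; rewrite (fun_tlift _ _ subhopf_val_linear).
have bs : bilin (fun c1 c2 : H => counit c2 *: c1).
  split=> w k u v; last by rewrite counit_is_scalar scalerDl scalerA.
  by rewrite scalerDr !scalerA mulrC.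
by rewrite -[RHS]counitr -subhopf_comulE [RHS]tlift_tmap.
Qed.

Lemma subhopf_comul1 : subhopf_comul 1 = 1 *t 1.
Proof.
apply: tmap_ev_inj.
by rewrite subhopf_comulE tmapE // subhopf_val1 comul1.
Qed.

Lemma subhopf_comulM : {morph subhopf_comul : x y / x * y >-> tmul x y}.
Proof.
move=> x y; apply: tmap_ev_inj.
by rewrite tmul_tmap // !subhopf_comulE -comulM.
Qed.

Lemma subhopf_counit1 : subhopf_counit 1 = 1.
Proof. by rewrite /subhopf_counit subhopf_val1 counit1. Qed.

Lemma subhopf_counitM : {morph subhopf_counit : x y / x * y}.
Proof. by move=> x y; rewrite /subhopf_counit -counitM. Qed.

Lemma subhopf_antipodel c :
  tlift (fun c1 c2 => subhopf_antipode c1 * c2) (subhopf_comul c) =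
  subhopf_counit c *: 1.
Proof.
apply: subhopf_val_inj; rewrite (fun_tlift _ _ subhopf_val_linear).
rewrite subhopf_valZ subhopf_val1 -antipodel -subhopf_comulE.
rewrite [RHS]tlift_tmap; last exact: antipode_bilinl.
by apply: eq_tlift => c1 c2; rewrite subhopf_valM -subhopf_antipodeE.
Qed.

Lemma subhopf_antipoder c :
  tlift (fun c1 c2 => c1 * subhopf_antipode c2) (subhopf_comul c) =
  subhopf_counit c *: 1.
Proof.
apply: subhopf_val_inj; rewrite (fun_tlift _ _ subhopf_val_linear).
rewrite subhopf_valZ subhopf_val1 -antipoder -subhopf_comulE.
rewrite [RHS]tlift_tmap; last exact: antipode_bilinr.
by apply: eq_tlift => c1 c2; rewrite subhopf_valM -subhopf_antipodeE.
Qed.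

HB.instance Definition _ := Falgebra_isHopf.Build K subhopf_of
  subhopf_comul_linear subhopf_counit_scalar subhopf_antipode_linear
  subhopf_comulA subhopf_counitl subhopf_counitr subhopf_comul1 subhopf_comulM
  subhopf_counit1 subhopf_counitM subhopf_antipodel subhopf_antipoder.

End SubHopfType.

Lemma is_subhopf_full : is_subhopf fullv.
Proof.
split=> [|x y _ _|x _|x _]; rewrite ?memvf //.
rewrite -[comul x]tlift_pure; apply: mem_tlift => u v.
by rewrite mem_tensorv ?memvf.
Qed.

Lemma tensorv_cap (A B : {vspace H}) t :
  t \in tensorv A A -> t \in tensorv B B -> t \in tensorv (A :&: B) (A :&: B).
Proof.
move=> At Bt.
pose C := (A :&: B)%VS.
have lp : linear (projv C) by exact: linearP.
have li := id_is_linear (U := H).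
have sl D u : t \in tensorv D D ->
    tlift (fun x y : H => coord (vbasis fullv) u x *: y) t \in D.
  have bl : bilin (fun x y : H => coord (vbasis fullv) u x *: y).
    split=> w c x y; first by rewrite linearP scalerDl scalerA.
    by rewrite scalerDr !scalerA mulrC.
  pose f := linfun (tlift (fun x y : H => coord (vbasis fullv) u x *: y)).
  move=> Dt; suff : (tensorv D D <= f @^-1: D)%VS.
    by move/subvP/(_ _ Dt); rewrite -memv_preim lfunE.
  apply: vspan_sub => _ [x [y [Dx Dy ->]]].
  by rewrite -memv_preim lfunE /= tliftE // memvZ.
have sr D u : t \in tensorv D D ->
    tlift (fun x y : H => coord (vbasis fullv) u y *: x) t \in D.
  have bl : bilin (fun x y : H => coord (vbasis fullv) u y *: x).
    split=> w c x y; last by rewrite linearP scalerDl scalerA.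
    by rewrite scalerDr !scalerA mulrC.
  pose f := linfun (tlift (fun x y : H => coord (vbasis fullv) u y *: x)).
  move=> Dt; suff : (tensorv D D <= f @^-1: D)%VS.
    by move/subvP/(_ _ Dt); rewrite -memv_preim lfunE.
  apply: vspan_sub => _ [x [y [Dx Dy ->]]].
  by rewrite -memv_preim lfunE /= tliftE // memvZ.
have slt (s : tensor H H) : s = \sum_(i < \dim {:H})
    (vbasis fullv)`_i *t tlift (fun x y : H => coord (vbasis fullv) i x *: y) s.
  move: s; apply: tensor_extP => [||x y].
  - exact: id_is_linear.
  - move=> c u v; rewrite scaler_sumr -big_split; apply: eq_bigr => i _.
    by rewrite tlift_is_linear (bilin_tpure _ _).2.
  rewrite {1}(coord_vbasis (memvf x)) (bilin_suml _ _ _ _ (bilin_tpure _ _)).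
  apply: eq_bigr => i _; rewrite tliftE; last first.
    split=> w c u v; first by rewrite linearP scalerDl scalerA.
    by rewrite scalerDr !scalerA mulrC.
  by rewrite (bilinZl _ _ _ (bilin_tpure _ _)) (bilinZr _ _ _ (bilin_tpure _ _)).
have srt (s : tensor H H) : s = \sum_(i < \dim {:H})
    tlift (fun x y : H => coord (vbasis fullv) i y *: x) s *t (vbasis fullv)`_i.
  move: s; apply: tensor_extP => [||x y].
  - exact: id_is_linear.
  - move=> c u v; rewrite scaler_sumr -big_split; apply: eq_bigr => i _.
    by rewrite tlift_is_linear (bilin_tpure _ _).1.
  rewrite {1}(coord_vbasis (memvf y)) (bilin_sumr _ _ _ _ (bilin_tpure _ _)).
  apply: eq_bigr => i _; rewrite tliftE; last first.
    split=> w c u v; last by rewrite linearP scalerDl scalerA.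
    by rewrite scalerDr !scalerA mulrC.
  by rewrite (bilinZl _ _ _ (bilin_tpure _ _)) (bilinZr _ _ _ (bilin_tpure _ _)).
have tl : tmap id (projv C) t = t.
  have lt := tmap_is_linear (id : H -> H) (projv C).
  rewrite [in RHS](slt t) {1}(slt t) (lin_sum _ _ _ lt); apply: eq_bigr => i _.
  by rewrite /= tmapE // projv_id // memv_cap !sl.
have tr : tmap (projv C) id t = t.
  have lt := tmap_is_linear (projv C) (id : H -> H).
  rewrite [in RHS](srt t) {1}(srt t) (lin_sum _ _ _ lt); apply: eq_bigr => i _.
  by rewrite /= tmapE // projv_id // memv_cap !sr.
rewrite -tr -tl /tmap tlift_tlift.
apply: mem_tlift => u v; rewrite tliftE; last exact: (bilin_comp (bilin_tpure _ _)).
by apply: mem_tensorv; apply: memv_proj.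
Qed.

Lemma is_subhopf_cap (A B : {vspace H}) :
  is_subhopf A -> is_subhopf B -> is_subhopf (A :&: B)%VS.
Proof.
case=> A1 AM AD AS [B1 BM BD BS]; split.
- by rewrite memv_cap A1.
- by move=> x y /memv_capP[Ax Bx] /memv_capP[Ay By]; rewrite memv_cap AM ?BM.
- by move=> x /memv_capP[Ax Bx]; apply: tensorv_cap; [apply: AD | apply: BD].
- by move=> x /memv_capP[Ax Bx]; rewrite memv_cap AS ?BS.
Qed.

Lemma subhopf_gen_exists (s : seq H) :
  exists A : subHopf, {subset s <= subhopf_vspace A} /\
    forall B : subHopf, {subset s <= subhopf_vspace B} ->
      (subhopf_vspace A <= subhopf_vspace B)%VS.
Proof.
have [n] : exists n, exists A : subHopf,
    {subset s <= subhopf_vspace A} /\ (\dim (subhopf_vspace A) < n)%N.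
  by exists (\dim {:H}).+1, (SubHopf is_subhopf_full); split=> // x _; rewrite memvf.
elim: n => [[A []]//|n IHn [A [sA leAn]]].
have [sub|] := EM (forall B : subHopf, {subset s <= subhopf_vspace B} ->
    (subhopf_vspace A <= subhopf_vspace B)%VS); first by exists A.
move=> /existsNP [B /not_implyP [sB /negP nAB]].
apply: IHn; exists (SubHopf (is_subhopf_cap (subhopfP A) (subhopfP B))).
split=> [x sx|]; first by rewrite memv_cap sA ?sB.
rewrite -ltnS; apply: leq_trans leAn; rewrite ltnS ltn_neqAle dimvS ?capvSl // andbT.
apply: contra nAB => /eqP eqd; apply/capv_idPl/eqP.
by rewrite eqEdim capvSl eqd leqnn.
Qed.

(* The smallest sub Hopf algebra containing s *)
Definition subhopf_gen (s : seq H) : subHopf := projT1 (cid (subhopf_gen_exists s)).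

Lemma mem_subhopf_gen (s : seq H) :
  {subset s <= subhopf_vspace (subhopf_gen s)}.
Proof. by rewrite /subhopf_gen; case: cid => A []. Qed.

Lemma subhopf_gen_min (s : seq H) (B : subHopf) :
  {subset s <= subhopf_vspace B} ->
  (subhopf_vspace (subhopf_gen s) <= subhopf_vspace B)%VS.
Proof. by rewrite /subhopf_gen; case: cid => A [_ mA] /=; apply: mA. Qed.

End SubHopf.

Section Smash.
Variables (K : fieldType) (G : finGroupType) (A : hopfType K).

(* An action of G on A by Hopf algebra automorphisms: A is a kG-module        *)
(* algebra, and comul and counit are kG-linear, which makes the smash product *)
(* with the tensor product coalgebra structure a Hopf algebra.                *)
Record hopf_action := HopfAction {
  hact :> G -> A -> A;
  hact_linear : forall g, linear (hact g);
  hact1g : forall u, hact 1%g u = u;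
  hactMg : forall g h u, hact (g * h)%g u = hact g (hact h u);
  hact1 : forall g, hact g 1 = 1;
  hactM : forall g, {morph hact g : u v / u * v};
  hact_comul : forall g u, comul (hact g u) = tmap (hact g) (hact g) (comul u);
  hact_counit : forall g u, counit (hact g u) = counit u
}.

(* The smash product A * kG: f stands for the sum over g of f(g) * g.         *)
Definition smash of hopf_action := {ffun G -> A}.
HB.instance Definition _ (rho : hopf_action) :=
  Vector.copy (smash rho) {ffun G -> A}.

Variable rho : hopf_action.
Local Notation smashR := (smash rho).

(* u * g *)
Definition smash_pure (u : A) (g : G) : smashR := [ffun h => if h == g then u else 0].

Definition smash_mul (f1 f2 : smashR) : smashR :=
  [ffun l => \sum_g f1 g * rho g (f2 (g^-1 * l)%g)].
Definition smash_one : smashR := smash_pure 1 1%g.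
Definition smash_comul (f : smashR) : tensor smashR smashR :=
  \sum_g tlift (fun u v => smash_pure u g *t smash_pure v g) (comul (f g)).
Definition smash_counit (f : smashR) : K := \sum_g counit (f g).
Definition smash_antipode (f : smashR) : smashR :=
  \sum_g smash_pure (rho g^-1%g (antipode (f g))) g^-1%g.

Lemma smash_pure_linear g : linear (fun u => smash_pure u g).
Proof.
by move=> c u v; apply/ffunP=> h; rewrite !ffunE; case: eqP; rewrite // scaler0 addr0.
Qed.

Lemma smash_sum (f : smashR) : f = \sum_g smash_pure (f g) g.
Proof.
apply/ffunP=> h; rewrite sum_ffunE (bigD1 h) //= ffunE eqxx big1 ?addr0 // => g ng.
by rewrite ffunE eq_sym (negbTE ng).
Qed.

Lemma smash_ext (V : vectType K) (f1 f2 : smashR -> V) : linear f1 -> linear f2 ->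
  (forall u g, f1 (smash_pure u g) = f2 (smash_pure u g)) -> f1 =1 f2.
Proof.
move=> l1 l2 e f; rewrite (smash_sum f) !lin_sum //.
by apply: eq_bigr => g _.
Qed.

Lemma hact0 g : rho g 0 = 0.
Proof. exact: lin0 (hact_linear rho g). Qed.

Lemma smash_mul_pure u g v h :
  smash_mul (smash_pure u g) (smash_pure v h) = smash_pure (u * rho g v) (g * h)%g.
Proof.
apply/ffunP=> l; rewrite !ffunE (bigD1 g) //= big1 => [|g' ng]; last first.
  by rewrite ffunE (negbTE ng) mul0r.
rewrite !ffunE eqxx addr0 -(inj_eq (mulgI g)) mulKVg.
by case: eqP => // _; rewrite hact0 mulr0.
Qed.

Lemma smash_mul_linearl f2 : linear (fun f1 => smash_mul f1 f2).
Proof.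
move=> c f1 f1'; apply/ffunP=> l; rewrite !ffunE scaler_sumr -big_split.
by apply: eq_bigr => g _; rewrite !ffunE mulrDl scalerAl.
Qed.

Lemma smash_mul_linearr f1 : linear (smash_mul f1).
Proof.
move=> c f2 f2'; apply/ffunP=> l; rewrite !ffunE scaler_sumr -big_split.
by apply: eq_bigr => g _; rewrite !ffunE hact_linear mulrDr scalerAr.
Qed.

Lemma smash_mulA : associative smash_mul.
Proof.
move=> f1 f2 f3; move: f1; apply: smash_ext => [||u g].
- exact: smash_mul_linearl.
- by apply: comp_is_linear (smash_mul_linearl _) (smash_mul_linearl _).
move: f2; apply: smash_ext => [||v h].
- exact: comp_is_linear (smash_mul_linearr _) (smash_mul_linearl _).
- exact: comp_is_linear (smash_mul_linearl _) (smash_mul_linearr _).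
move: f3; apply: smash_ext => [||w l].
- exact: comp_is_linear (smash_mul_linearr _) (smash_mul_linearr _).
- exact: smash_mul_linearr.
by rewrite !smash_mul_pure hactM hactMg !mulrA mulgA.
Qed.

Lemma smash_mul1 : left_id smash_one smash_mul.
Proof.
apply: smash_ext => [||u g].
- exact: smash_mul_linearr.
- exact: id_is_linear.
- by rewrite smash_mul_pure mul1r mul1g hact1g.
Qed.

Lemma smash_mulr1 : right_id smash_one smash_mul.
Proof.
apply: smash_ext => [||u g].
- exact: smash_mul_linearl.
- exact: id_is_linear.
- by rewrite smash_mul_pure hact1 mulr1 mulg1.
Qed.

Lemma smash_mulDl : left_distributive smash_mul +%R.
Proof. move=> f1 f2 f; exact: (linD (smash_mul_linearl f)). Qed.
Lemma smash_mulDr : right_distributive smash_mul +%R.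
Proof. move=> f f1 f2; exact: (linD (smash_mul_linearr f)). Qed.
Lemma smash_one_neq0 : smash_one != 0.
Proof.
apply/eqP=> /ffunP/(_ 1%g); rewrite !ffunE eqxx => /eqP.
by rewrite oner_eq0.
Qed.

HB.instance Definition _ := GRing.Zmodule_isNzRing.Build smashR
  smash_mulA smash_mul1 smash_mulr1 smash_mulDl smash_mulDr smash_one_neq0.

Lemma smash_scaleAl c (x y : smashR) : c *: (x * y) = (c *: x) * y.
Proof. exact/esym/(linZ _ _ (smash_mul_linearl y)). Qed.
HB.instance Definition _ := GRing.Lmodule_isLalgebra.Build K smashR smash_scaleAl.

Lemma smash_scaleAr c (x y : smashR) : c *: (x * y) = x * (c *: y).
Proof. exact/esym/(linZ _ _ (smash_mul_linearr x)). Qed.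
HB.instance Definition _ := GRing.Lalgebra_isAlgebra.Build K smashR smash_scaleAr.
HB.instance Definition _ := Algebra_isFalgebra.Build K smashR.

Let pure := fun g u => smash_pure u g.
Let pure_lin : forall g, linear (pure g) := smash_pure_linear.
Hint Resolve pure_lin : core.

Lemma smash_mulE u g v h :
  smash_pure u g * smash_pure v h = smash_pure (u * rho g v) (g * h)%g.
Proof. exact: smash_mul_pure. Qed.

Lemma smash_comul_linear : linear smash_comul.
Proof.
move=> c f f'; rewrite /smash_comul scaler_sumr -big_split; apply: eq_bigr => g _.
by rewrite !ffunE comul_is_linear tlift_is_linear.
Qed.

Lemma smash_counit_scalar : scalar smash_counit.
Proof.
move=> c f f'; rewrite /smash_counit /= mulr_sumr -big_split; apply: eq_bigr => g _.
by rewrite !ffunE counit_is_scalar.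
Qed.

Lemma smash_antipode_linear : linear smash_antipode.
Proof.
move=> c f f'; rewrite /smash_antipode scaler_sumr -big_split; apply: eq_bigr => g _.
by rewrite !ffunE antipode_is_linear hact_linear smash_pure_linear.
Qed.

Lemma smash_comul_pure u g :
  smash_comul (smash_pure u g) = tmap (pure g) (pure g) (comul u).
Proof.
rewrite /smash_comul (bigD1 g) //= ffunE eqxx big1 ?addr0 // => h nh.
by rewrite ffunE (negbTE nh) (lin0 (@comul_is_linear K A)) (lin0 (tlift_is_linear _)).
Qed.

Lemma smash_counit_pure u g : smash_counit (smash_pure u g) = counit u.
Proof.
rewrite /smash_counit (bigD1 g) //= ffunE eqxx big1 ?addr0 // => h nh.
by rewrite ffunE (negbTE nh) linear0.
Qed.

Lemma smash_antipode_pure u g :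
  smash_antipode (smash_pure u g) = smash_pure (rho g^-1%g (antipode u)) g^-1%g.
Proof.
rewrite /smash_antipode (bigD1 g) //= ffunE eqxx big1 ?addr0 // => h nh.
rewrite ffunE (negbTE nh) (lin0 (@antipode_is_linear K A)) hact0.
exact: (lin0 (pure_lin _)).
Qed.

Lemma smash_comulA c :
  tlift (fun c1 c2 => smash_comul c1 *t c2) (smash_comul c) =
  tlift (fun c1 c2 => tlift (fun d1 d2 => (c1 *t d1) *t d2) (smash_comul c2))
      (smash_comul c).
Proof.
move: c; apply: smash_ext => [||u g].
- by apply: comp_is_linear; [exact: tlift_is_linear | exact: smash_comul_linear].
- by apply: comp_is_linear; [exact: tlift_is_linear | exact: smash_comul_linear].
have lpp : linear (tmap (pure g) (pure g)) by apply: tmap_is_linear.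
rewrite smash_comul_pure tlift_tmap; last first.
  by apply: (bilin_comp (bilin_tpure _ _)) => //; exact: smash_comul_linear.
rewrite tlift_tmap; last first.
  apply: bilin_sweedler => [|d1 d2]; first exact: smash_comul_linear.
  exact: (comp_is_linear (tpure_linearl d2) (tpure_linearl d1)).
have := congr1 (tmap (tmap (pure g) (pure g)) (pure g)) (comulA u).
rewrite !(fun_tlift _ _ (tmap_is_linear _ _)).
under eq_tlift => c1 c2 do rewrite tmapE // -smash_comul_pure.
move=> ->; apply: eq_tlift => c1 c2.
rewrite smash_comul_pure tlift_tmap; last first.
  by apply: (bilin_comp (bilin_tpure _ _)) => //; exact: tpure_linearr.
rewrite (fun_tlift _ _ (tmap_is_linear _ _)); apply: eq_tlift => d1 d2.
by rewrite !tmapE.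
Qed.

Lemma smash_counitl c :
  tlift (fun c1 c2 => smash_counit c1 *: c2) (smash_comul c) = c.
Proof.
move: c; apply: smash_ext => [||u g].
- by apply: comp_is_linear; [exact: tlift_is_linear | exact: smash_comul_linear].
- exact: id_is_linear.
rewrite smash_comul_pure tlift_tmap; last first.
  split=> w k x y; first by rewrite smash_counit_scalar scalerDl scalerA.
  by rewrite scalerDr !scalerA mulrC.
rewrite -[u in RHS]counitl -[RHS]/(pure g _) (fun_tlift _ _ (pure_lin g)).
by apply: eq_tlift => c1 c2; rewrite smash_counit_pure (linZ _ _ (pure_lin g)).
Qed.

Lemma smash_counitr c :
  tlift (fun c1 c2 => smash_counit c2 *: c1) (smash_comul c) = c.
Proof.
move: c; apply: smash_ext => [||u g].
- by apply: comp_is_linear; [exact: tlift_is_linear | exact: smash_comul_linear].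
- exact: id_is_linear.
rewrite smash_comul_pure tlift_tmap; last first.
  split=> w k x y; last by rewrite smash_counit_scalar scalerDl scalerA.
  by rewrite scalerDr !scalerA mulrC.
rewrite -[u in RHS]counitr -[RHS]/(pure g _) (fun_tlift _ _ (pure_lin g)).
by apply: eq_tlift => c1 c2; rewrite smash_counit_pure (linZ _ _ (pure_lin g)).
Qed.

Lemma smash_comul1 : smash_comul 1 = 1 *t 1.
Proof. by rewrite [1 in LHS]/(smash_pure 1 1%g) smash_comul_pure comul1 tmapE. Qed.

Lemma smash_comulM : {morph smash_comul : x y / x * y >-> tmul x y}.
Proof.
move=> f1 f2; move: f1; apply: smash_ext => [||u g].
- exact: comp_is_linear smash_comul_linear (smash_mul_linearl _).
- exact: comp_is_linear (tmul_linearl _) smash_comul_linear.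
move: f2; apply: smash_ext => [||v h].
- exact: comp_is_linear smash_comul_linear (smash_mul_linearr _).
- exact: comp_is_linear (tmul_linearr _) smash_comul_linear.
rewrite smash_mulE !smash_comul_pure comulM hact_comul.
move: (comul u) (comul v) => s t.
have lr := hact_linear rho g.
have lrr : linear (tmap (rho g) (rho g)) by apply: tmap_is_linear.
have lp k : linear (tmap (pure k) (pure k)) by apply: tmap_is_linear.
move: s; apply: tensor_extP => [||a b].
- exact: comp_is_linear (lp _) (tmul_linearl _).
- exact: comp_is_linear (tmul_linearl _) (lp _).
move: t; apply: tensor_extP => [||a' b'].
- exact: comp_is_linear (comp_is_linear (lp _) (tmul_linearr _)) lrr.
- exact: comp_is_linear (tmul_linearr _) (lp _).
by rewrite !tmapE // !tmul_pure tmapE // /pure !smash_mulE.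
Qed.

Lemma smash_counit1 : smash_counit 1 = 1.
Proof. by rewrite [1 in LHS]/(smash_pure 1 1%g) smash_counit_pure counit1. Qed.

Lemma smash_counitM : {morph smash_counit : x y / x * y}.
Proof.
have lc : linear (smash_counit : smashR -> K^o) by exact: smash_counit_scalar.
move=> f1 f2; move: f1; apply: (@smash_ext K^o) => [||u g].
- exact: comp_is_linear lc (smash_mul_linearl _).
- by move=> c x y; rewrite /= smash_counit_scalar mulrDl scalerAl.
move: f2; apply: (@smash_ext K^o) => [||v h].
- exact: comp_is_linear lc (smash_mul_linearr _).
- by move=> c x y; rewrite /= smash_counit_scalar mulrDr mulrCA.
by rewrite smash_mulE !smash_counit_pure counitM hact_counit.
Qed.

Lemma smash_antipodel c :
  tlift (fun c1 c2 => smash_antipode c1 * c2) (smash_comul c) =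
  smash_counit c *: 1.
Proof.
move: c; apply: smash_ext => [||u g].
- by apply: comp_is_linear; [exact: tlift_is_linear | exact: smash_comul_linear].
- by move=> c x y; rewrite smash_counit_scalar scalerDl scalerA.
rewrite smash_comul_pure tlift_tmap; last first.
  by apply: (bilin_comp (bilin_mul smashR)) => //; exact: smash_antipode_linear.
rewrite smash_counit_pure [1]/(pure 1%g 1) -(linZ _ _ (pure_lin _)).
rewrite -(hact1 rho g^-1%g) -(linZ _ _ (hact_linear _ _)) -antipodel.
rewrite (fun_tlift _ _ (hact_linear _ _)) (fun_tlift _ _ (pure_lin _)).
apply: eq_tlift => c1 c2; rewrite /pure smash_antipode_pure smash_mulE.
by rewrite -hactM mulVg.
Qed.

Lemma smash_antipoder c :
  tlift (fun c1 c2 => c1 * smash_antipode c2) (smash_comul c) =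
  smash_counit c *: 1.
Proof.
move: c; apply: smash_ext => [||u g].
- by apply: comp_is_linear; [exact: tlift_is_linear | exact: smash_comul_linear].
- by move=> c x y; rewrite smash_counit_scalar scalerDl scalerA.
rewrite smash_comul_pure tlift_tmap; last first.
  by apply: (bilin_comp (bilin_mul smashR)) => //; exact: smash_antipode_linear.
rewrite smash_counit_pure [1]/(pure 1%g 1) -(linZ _ _ (pure_lin _)).
rewrite -antipoder (fun_tlift _ _ (pure_lin _)).
apply: eq_tlift => c1 c2; rewrite /pure smash_antipode_pure smash_mulE.
by rewrite -hactMg mulgV hact1g.
Qed.

HB.instance Definition _ := Falgebra_isHopf.Build K smashR
  smash_comul_linear smash_counit_scalar smash_antipode_linear
  smash_comulA smash_counitl smash_counitr smash_comul1 smash_comulM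
  smash_counit1 smash_counitM smash_antipodel smash_antipoder.

End Smash.

Definition is_hopf_hom (K : fieldType) (A B : hopfType K) (f : 'Hom(A, B)) : Prop :=
  [/\ f 1 = 1,
      {morph f : x y / x * y},
      forall x, comul (f x) = tmap f f (comul x),
      forall x, counit (f x) = counit x &
      {morph f : x / antipode x}].

Definition ideal_gen (K : fieldType) (A : falgType K) (t : A) : {vspace A} :=
  ({:A} * <[t]> * {:A})%VS.

(* Main.v *)
Require Import Defs.
From HB Require Import structures.
From mathcomp Require Import all_boot all_order all_fingroup all_algebra.
From mathcomp Require Import falgebra cyclic boolp.

Set Implicit Arguments.
Unset Strict Implicit.
Unset Printing Implicit Defensive.

Import GRing.Theory.

Local Open Scope ring_scope.

(** Write H_0 = kG with G the group of group-likes, and n for the degree of x.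

    The engine is the coproduct of the elements g x^i. Since the two terms of
    comul x = x (x) a + 1 (x) x commute up to q, the q-binomial theorem expresses
    comul (g x^i) through the vectors g x^(i-j) (x) g a^(i-j) x^j with Gaussian binomials as
    coefficients (comul_pbw). It follows first that the g x^i with i < n are linearly
    independent (pbw_indep), so that coefficients in comul y can be compared
    (comul_coef). For a skew primitive y in the span of the g x^i with i < n this
    comparison leaves only y = c (b - 1) + sum_i d_i x^i, where d_i <> 0 forces a^i = b and the
    vanishing of all middle Gaussian binomials in row i (skew_primitive_below).

    For (1), the middle binomials of row n vanish because x^n is an H_0-combination of
    lower powers. In characteristic p and at a primitive N-th root of unity this
    happens only when n = N p^r (gbin_row_eq0). Then x^n is itself skew primitive, and the
    shape of skew primitives is the claimed relation.

    In rank one everything rests on the inclusion of H_1 in H_0 + H_0 x (coradical1_rank1).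
    The space H_1 / H_0 is graded by G through the coproduct, and G permutes the degrees;
    so k (x)_(H_0) (H_1 / H_0) is the component of degree 1, and rank one says that it
    is the line of a^-1 x. Hence no power of x strictly between x and x^n is skew
    primitive, which is (2), and a skew primitive is c (b - 1) + d x with b = a unless d = 0.
    Applied to g x g^-1 this gives g x g^-1 = c (a - 1) + d x and g a = a g. For (3), one more
    conjugation by a kills c when q <> 1. For (4), y = x - beta (a - 1) with beta^p = alpha_(-1)
    satisfies y^p = 0, and the p-th power of g y g^-1 = e (a - 1) + d y gives e^p (a^p - 1) = 0.

    For (5), the formula for g x g^-1 shows that A is stable under conjugation, and (1) that it
    is spanned by the a^j x^i with i < n. Modulo the ideal generated by a*1 - 1*a every
    element of the smash product is therefore a combination of the g x^i with i < n, whose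
    images in H are independent: the kernel is no larger than the ideal. *)

(** * Gaussian binomials at a root of unity *)

Section GaussianBinomial.
Variables (k : fieldType) (q : k).

(** The coefficient of B^(n-j) A^j in (B + A)^n when A B = q B A. *)
Fixpoint gbin (n j : nat) : k :=
  match n, j with
  | _, 0 => 1
  | 0, _.+1 => 0
  | n'.+1, j'.+1 => gbin n' j' + q ^+ j * gbin n' j
  end.

Lemma gbin0 n : gbin n 0 = 1. Proof. by case: n. Qed.

Lemma gbinS n j : gbin n.+1 j.+1 = gbin n j + q ^+ j.+1 * gbin n j.+1.
Proof. by []. Qed.

Lemma gbin_small n j : (n < j)%N -> gbin n j = 0.
Proof.
elim: n j => [|n IHn] [|j] //= lt_nj.
by rewrite !IHn ?mulr0 ?addr0 // ltnW.
Qed.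

Lemma gbinnn n : gbin n n = 1.
Proof. by elim: n => //= n ->; rewrite gbin_small ?mulr0 ?addr0. Qed.

(** The other Pascal rule, obtained when the additional factor of (B + A)^(n+1) is
    placed on the left. *)
Lemma gbinS' n j : (j <= n)%N ->
  gbin n.+1 j.+1 = q ^+ (n - j) * gbin n j + gbin n j.+1.
Proof.
elim: n j => [|n IHn] [|j] // le_jn.
- by rewrite /= !mulr0 !addr0 mulr1.
- rewrite gbinS [in LHS]IHn // [in RHS]gbinS !gbin0 !subn0 !mulr1 mulrDr expr1.
  by rewrite -exprS addrCA.
have [lt_jn|ge_jn] := ltnP j n.
  rewrite gbinS [in LHS]IHn // [in LHS]IHn //.
  rewrite [gbin n.+1 j.+1 in RHS]gbinS [gbin n.+1 j.+2 in RHS]gbinS.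
  rewrite subSS !mulrDr !mulrA -!exprD.
  have -> : (j.+2 + (n - j.+1) = n - j + j.+1)%N by rewrite -(subnSK lt_jn) !addnS !addSn addnC.
  by rewrite addrACA.
have -> : j = n by apply/eqP; rewrite eqn_leq ge_jn -ltnS le_jn.
by rewrite gbinS subnn mul1r gbinnn !(@gbin_small _ n.+2) ?mulr0 ?addr0.
Qed.

Lemma gbin_n1 n : gbin n 1 * (q - 1) = q ^+ n - 1.
Proof.
elim: n => [|n IHn]; first by rewrite mul0r subrr.
by rewrite gbinS gbin0 mulrDl mul1r expr1 -mulrA IHn mulrBr mulr1 -exprS addrC addrA subrK.
Qed.

Section PrimitiveRoot.
Variables (N : nat) (prim_q : N.-primitive_root q).

Let N_gt0 := prim_order_gt0 prim_q.

(** Comparing the two Pascal rules gives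
    (1 - q^(N-j)) [N, j] = (1 - q^(j+1)) [N, j+1], so the vanishing of
    1 - q^N propagates to every [N, j] until the factor 1 - q^(j+1) vanishes. *)
Lemma gbin_prim_mid j : (0 < j < N)%N -> gbin N j = 0.
Proof.
case: j => // j; elim: j => [|j IHj] ltjN.
  have /eqP := gbin_n1 N; rewrite (prim_expr_order prim_q) subrr mulf_eq0 subr_eq0.
  case/orP=> [/eqP //|/eqP q1]; have := prim_order_dvd prim_q 1.
  by rewrite expr1 q1 eqxx dvdn1 => /eqP N1; rewrite N1 in ltjN.
have ltjN' : (j.+1 < N)%N by apply: ltnW.
have := gbinS' (ltnW ltjN'); rewrite gbinS (IHj ltjN') mulr0 !add0r => /eqP.
rewrite -subr_eq0 -{2}[gbin _ _]mul1r -mulrBl mulf_eq0 => /orP[|/eqP //].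
rewrite subr_eq0 -(prim_order_dvd prim_q) gtnNdvd //.
Qed.

(** For a primitive N-th root of unity (B + A)^N = B^N + A^N, and B^N commutes with A. *)
Lemma gbin_addN n j :
  gbin (n + N) j = gbin n j + (if (N <= j)%N then gbin n (j - N) else 0).
Proof.
elim: n j => [|n IHn] [|j].
- by rewrite !gbin0 leqNgt N_gt0 addr0.
- rewrite add0n [gbin 0 j.+1]/= add0r; case: ltngtP => [ltNj|ltjN|->].
  + by rewrite gbin_small // (subSn (ltnSE ltNj)).
  + by apply: gbin_prim_mid.
  + by rewrite gbinnn subnn.
- by rewrite !gbin0 leqNgt N_gt0 addr0.
rewrite addSn !gbinS !IHn; case: (ltngtP j.+1 N) => [ltjN|ltNj|eNj].
- by rewrite leqNgt (ltnW ltjN) !addr0.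
- rewrite -ltnS ltNj (subSn (ltnSE ltNj)) gbinS -(subSn (ltnSE ltNj)) mulrDr addrACA.
  congr (_ + (_ + _ * _)).
  rewrite -{1}(subnK (ltnW ltNj)) exprD (prim_expr_order prim_q) mulr1.
  by rewrite (subSn (ltnSE ltNj)).
- rewrite -eNj ltnn subnn !gbin0 addr0 mulrDr addrA mulr1; congr (_ + _).
  by rewrite eNj (prim_expr_order prim_q).
Qed.

Lemma gbin_mulN m j : gbin (N * m) (N * j) = 'C(m, j)%:R.
Proof.
elim: m j => [|m IHm] j.
  rewrite muln0; case: j => [|j]; first by rewrite muln0.
  by rewrite gbin_small // mulnS addn_gt0 N_gt0.
rewrite mulnS addnC gbin_addN; case: j => [|j].
  by rewrite muln0 leqNgt N_gt0 gbin0 addr0 bin0.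
by rewrite mulnS leq_addr addKn -mulnS !IHm binS natrD.
Qed.

End PrimitiveRoot.
End GaussianBinomial.

Arguments gbin : simpl never.

Lemma coef_XD1n (R : comNzRingType) n j : (('X + 1 : {poly R}) ^+ n)`_j = 'C(n, j)%:R.
Proof.
rewrite exprD1n coef_sum; have [le_jn|lt_nj] := leqP j n.
  rewrite (bigD1 (Ordinal (le_jn : (j < n.+1)%N))) //= coefMn coefXn eqxx big1 ?addr0 // => i.
  by rewrite -val_eqE /= coefMn coefXn eq_sym => /negPf ->; rewrite mul0rn.
rewrite bin_small // big1 // => i _; rewrite coefMn coefXn gtn_eqF ?mul0rn //.
exact: leq_ltn_trans (leq_ord i) lt_nj.
Qed.

(** Write m = p^s u with p not dividing u. By the Frobenius,
    (X + 1)^m = (X^(p^s) + 1)^u, so the coefficient of X^(p^s) is u, a unit of k;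
    it can only be one of the two extreme coefficients, so that u = 1. *)
Lemma bin_mid_eq0 (k : fieldType) p m : p \in [pchar k] -> (0 < m)%N ->
  (forall j, (0 < j < m)%N -> 'C(m, j)%:R = 0 :> k) -> exists s, m = (p ^ s)%N.
Proof.
move=> char_p m_gt0 binm0; have p_pr := pcharf_prime char_p.
have [u] := pfactor_coprime p_pr m_gt0; rewrite prime_coprime // => pNu.
set s := logn p m => me; exists s; set d := (p ^ s)%N in me *.
have d_gt0 : (0 < d)%N by rewrite expn_gt0 prime_gt0.
have [u1|u_neq1] := eqVneq u 1%N; first by rewrite me u1 mul1n.
have lt_dm : (d < m)%N.
  rewrite me -[X in (X < _)%N]mul1n ltn_pmul2r // ltn_neqAle eq_sym u_neq1.
  by case: (u) pNu => //; rewrite dvdn0.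
have pnat_d : ([pchar {poly k}].-nat d)%N by rewrite pnatX pnatE // pchar_poly char_p.
have : ('X + 1 : {poly k}) ^+ m = (('X + 1) ^+ u) \Po 'X^d.
  by rewrite me mulnC exprM exprDn_pchar // expr1n rmorphXn /= rmorphD /= comp_polyX rmorph1.
move/(congr1 (fun f : {poly k} => f`_d)); rewrite coef_comp_poly_Xn // dvdnn divnn d_gt0.
rewrite !coef_XD1n bin1 binm0 ?d_gt0 // => /esym/eqP.
by rewrite -(dvdn_pcharf char_p) (negPf pNu).
Qed.

(** If all middle Gaussian binomials of row i vanish, so does [i, 1], whence q^i = 1
    and i = N m; the row of i then contains the ordinary row of m. *)
Lemma gbin_row_eq0 (k : fieldType) (q : k) p N i : p \in [pchar k] ->
  N.-primitive_root q -> (0 < i)%N -> (forall j, (0 < j < i)%N -> gbin q i j = 0) ->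
  i = 1%N \/ exists s, i = (N * p ^ s)%N.
Proof.
move=> char_p prim_q i_gt0 gbin0; have [->|i_neq1] := eqVneq i 1%N; [by left | right].
have N_gt0 := prim_order_gt0 prim_q.
have /dvdnP[m im] : (N %| i)%N.
  rewrite (prim_order_dvd prim_q) -subr_eq0 -gbin_n1 gbin0 ?mul0r //.
  by rewrite /= ltn_neqAle eq_sym i_neq1 i_gt0.
rewrite mulnC in im; have m_gt0 : (0 < m)%N by move: i_gt0; rewrite im muln_gt0 => /andP[].
have [|s me] := bin_mid_eq0 char_p m_gt0; last by exists s; rewrite -me.
move=> j /andP[j_gt0 ltjm]; rewrite -(gbin_mulN prim_q) -im gbin0 //.
by rewrite im muln_gt0 N_gt0 j_gt0 ltn_pmul2l.
Qed.

(** * Linear algebra, group-likes and the antipode *)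

Section LinearAlgebra.
Variables (K : fieldType) (V : vectType K).

Lemma mem_sum_linesP (I : finType) (f : I -> V) (y : V) :
  reflect (exists c : I -> K, y = \sum_i c i *: f i) (y \in (\sum_i <[f i]>)%VS).
Proof.
apply: (iffP idP) => [/memv_sumP[w wf ->]|[c ->]]; last first.
  by apply: memv_sumr => i _; rewrite memvZ // memv_line.
have cP i : exists c, w i == c *: f i by have /vlineP[c ->] := wf i isT; exists c.
exists (fun i => xchoose (cP i)); apply: eq_bigr => i _.
exact/eqP/(xchooseP (cP i)).
Qed.

Lemma dual_family (I : finType) (v : I -> V) :
  (forall c : I -> K, \sum_i c i *: v i = 0 -> forall i, c i = 0) ->
  exists phi : I -> V -> K^o,
    (forall i, linear (phi i)) /\ forall i j, phi i (v j) = (i == j)%:R.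
Proof.
move=> v_indep; pose X := [tuple v (enum_val i) | i < #|I|].
have XE (i : 'I_#|I|) : X`_i = v (enum_val i) by rewrite -tnth_nth tnth_mktuple.
have freeX : free X.
  apply/freeP=> c c0 i; rewrite -[i]enum_valK.
  apply: (v_indep (fun j => c (enum_rank j))).
  rewrite -[RHS]c0 [RHS](reindex enum_rank) /=; last exact/onW_bij/enum_rank_bij.
  by apply: eq_bigr => j _; rewrite XE enum_rankK.
exists (fun i => coord X (enum_rank i)); split=> [i|i j]; first exact: linearP.
have := XE (enum_rank j); rewrite enum_rankK => <-.
by rewrite coord_free // (inj_eq enum_rank_inj) eq_sym.
Qed.

(** That f carries a span into U is proved as the inclusion of this span in the preimage,
    which only has to be checked on the spanning vectors. *)
Lemma linear_preim (W : vectType K) (f : V -> W) (U : {vspace W}) : linear f ->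
  exists U' : {vspace V}, forall v, (v \in U') = (f v \in U).
Proof.
move=> lf; pose f' := HB.pack_for {linear V -> W} f (GRing.isLinear.Build K V W _ f lf).
by exists (linfun f' @^-1: U)%VS => v; rewrite -memv_preim lfunE.
Qed.

End LinearAlgebra.

Section LinearCombinations.
Variables (k : fieldType) (V W : vectType k).

Lemma sub_is_linear (f g : V -> W) : linear f -> linear g -> linear (fun v => f v - g v).
Proof. by move=> lf lg l u v; rewrite lf lg scalerBr opprD addrACA. Qed.

Lemma sum_is_linear (I : finType) (f : I -> V -> W) :
  (forall i, linear (f i)) -> linear (fun v => \sum_i f i v).
Proof.
move=> lf l u v; rewrite scaler_sumr -big_split; apply: eq_bigr => i _ /=.
exact: lf.
Qed.

Lemma linB (h : V -> W) : linear h -> {morph h : u v / u - v}.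
Proof. by move=> lh u v; rewrite addrC -scaleN1r lh scaleN1r addrC. Qed.

End LinearCombinations.

Section MulLinear.
Variables (k : fieldType) (H : hopfType k).

Lemma mull_is_linear (y : H) : linear (fun u => y * u).
Proof. by move=> l u v; rewrite mulrDr scalerAr. Qed.

Lemma mulr_is_linear (y : H) : linear (fun u => u * y).
Proof. by move=> l u v; rewrite mulrDl scalerAl. Qed.

Lemma bilin_counit : bilin (fun c1 c2 : H => counit c2 *: c1).
Proof.
split=> w c u v; last by rewrite counit_is_scalar scalerDl scalerA.
by rewrite scalerDr !scalerA mulrC.
Qed.

End MulLinear.

Section Grouplike.
Variables (K : fieldType) (H : hopfType K).
Implicit Types (g h : grouplike H).

Lemma glval1 : glval (1%g : grouplike H) = 1. Proof. by []. Qed.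
Lemma glvalM g h : glval (g * h)%g = glval g * glval h. Proof. by []. Qed.
Lemma glval_mulV g : glval g * glval g^-1%g = 1.
Proof. by rewrite -glvalM mulgV. Qed.
Lemma glval_mulVl g : glval g^-1%g * glval g = 1.
Proof. by rewrite -glvalM mulVg. Qed.
Lemma glval_unit g : glval g \is a GRing.unit.
Proof. by apply/unitrP; exists (glval g^-1%g); rewrite glval_mulV glval_mulVl. Qed.
Lemma glvalV g : glval g^-1%g = (glval g)^-1.
Proof. by apply: (mulrI (glval_unit g)); rewrite glval_mulV mulrV ?glval_unit. Qed.
Lemma glvalX g n : glval (g ^+ n)%g = glval g ^+ n.
Proof. by elim: n => // n IHn; rewrite expgS exprS glvalM IHn. Qed.

Lemma glval_indep (c : grouplike H -> K) :
  \sum_g c g *: glval g = 0 -> forall g, c g = 0.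
Proof.
move=> c0 g; pose X := map_tuple (@glval K H) [tuple enum_val i | i < #|{: grouplike H}|].
have XE (i : 'I_#|{: grouplike H}|) : X`_i = glval (enum_val i).
  by rewrite -tnth_nth tnth_map tnth_mktuple.
have /freeP s_indep : free X.
  apply: grouplike_free; rewrite map_inj_uniq ?enum_uniq //; exact: enum_val_inj.
have := s_indep (fun i => c (enum_val i)) _ (enum_rank g); rewrite enum_rankK; apply.
rewrite -[RHS]c0 [RHS](reindex (@enum_val (grouplike H) {: grouplike H})) /=.
  by apply: eq_bigr => i _; rewrite XE.
exact/onW_bij/enum_val_bij.
Qed.

Lemma glval_inj : injective (@glval K H). Proof. exact: val_inj. Qed.

Lemma glval_neq0 g : glval g != 0.
Proof.
apply/eqP=> g0; have [_] := glvalP g.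
by rewrite g0 linear0 => /eqP; rewrite eq_sym oner_eq0.
Qed.

Lemma glval_coradical g : glval g \in coradical H.
Proof.
have [Dg _] := glvalP g.
apply: mem_vspan; exists <[glval g]>%VS; last exact: memv_line.
split=> [c /vlineP[l ->]||D _ sDg].
- by rewrite linearZ /= Dg memvZ // mem_tensorv ?memv_line.
- by move/eqP; rewrite -dimv_eq0 dim_vline glval_neq0.
have [->|Dn0] := eqVneq D 0%VS; [by left | right].
by apply/eqP; rewrite eqEdim sDg dim_vline glval_neq0 lt0n dimv_eq0.
Qed.

End Grouplike.

Section PointedCoradical.
Variables (K : fieldType) (H : hopfType K).
Hypothesis pointed_H : pointed H.

(** A simple subcoalgebra of dimension one is spanned by a vector c with
    comul c = l (c (x) c); applying the counit gives l counit(c) = 1, so that l c is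
    group-like. *)
Lemma mem_coradicalP (y : H) :
  reflect (exists c : grouplike H -> K, y = \sum_g c g *: glval g) (y \in coradical H).
Proof.
have -> : coradical H = (\sum_(g : grouplike H) <[glval g]>)%VS; last exact: mem_sum_linesP.
apply/eqP; rewrite eqEsubv; apply/andP; split; last first.
  by apply/subv_sumP=> g _; rewrite -memvE glval_coradical.
apply: vspan_sub => c [C simC Cc]; have [subC _ _] := simC.
have [->|c0] := eqVneq c 0; first exact: mem0v.
have Ce : C = <[c]>%VS.
  by apply/esym/eqP; rewrite eqEdim -memvE Cc (pointed_H simC) dim_vline c0.
have [l Dc] : exists l, comul c = l *: (c *t c).
  apply/vlineP; have := subC _ Cc; rewrite Ce; apply/subvP/vspan_sub.
  move=> _ [u [v [/vlineP[l ->] /vlineP[m ->] ->]]].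
  by rewrite (bilinZl _ _ _ (bilin_tpure _ _)) (bilinZr _ _ _ (bilin_tpure _ _)) !memvZ ?memv_line.
have le1 : l * counit c = 1.
  have := counitl c; rewrite Dc (linZ _ _ (tlift_is_linear _)) tliftE; last first.
    split=> w k u v; first by rewrite counit_is_scalar scalerDl scalerA.
    by rewrite scalerDr !scalerA mulrC.
  rewrite scalerA => /eqP; rewrite -subr_eq0 -{3}[c]scale1r -scalerBl scaler_eq0 (negPf c0) orbF.
  by rewrite subr_eq0 => /eqP.
have g_lc : is_grouplike (l *: c).
  rewrite /is_grouplike !linearZ /= Dc le1 eqxx andbT.
  by rewrite (bilinZl _ _ _ (bilin_tpure _ _)) (bilinZr _ _ _ (bilin_tpure _ _)).
have -> : c = counit c *: glval (Grouplike g_lc) by rewrite /= scalerA mulrC le1 scale1r.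
by rewrite memvZ // (subvP (sumv_sup (Grouplike g_lc) _ (subvv _))) // memv_line.
Qed.

Lemma coradical_mull g y : y \in coradical H -> glval g * y \in coradical H.
Proof.
case/mem_coradicalP=> c ->; rewrite mulr_sumr; apply: rpred_sum => h _.
by rewrite -scalerAr memvZ // -glvalM glval_coradical.
Qed.

Lemma glval_dual : exists phi : grouplike H -> H -> K^o,
  (forall g, linear (phi g)) /\ forall g h, phi g (glval h) = (g == h)%:R.
Proof. exact: dual_family (@glval_indep K H). Qed.

End PointedCoradical.

Section Antipode.
Variables (K : fieldType) (H : hopfType K).
Implicit Types (g : grouplike H) (u : H).

(** The antipode is the convolution inverse of the identity, so an equation
    L * id = w counit in the convolution algebra can be solved for L. *)
Lemma antipode_unique (L : H -> H) (w : H) : linear L ->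
  (forall u, tlift (fun u1 u2 => L u1 * u2) (comul u) = counit u *: w) ->
  forall u, L u = w * antipode u.
Proof.
move=> lL Lw u; have lS := @antipode_is_linear K H.
pose F (t : tensor H H) (c : H) := tlift (fun u1 u2 => L u1 * u2) t * antipode c.
have lF1 c : linear (F^~ c).
  by move=> l s t; rewrite /F tlift_is_linear mulrDl scalerAl.
have lF2 t : linear (F t).
  by move=> l s c; rewrite /F lS mulrDr scalerAr.
have := congr1 (tlift F) (comulA u); rewrite !tlift_tlift.
have bF : bilin F by split.
under eq_tlift => c1 c2 do rewrite tliftE // /F Lw.
have <- : w * antipode u = tlift (fun a b => (counit a *: w) * antipode b) (comul u).
  rewrite -{1}[u]counitl (fun_tlift _ _ lS) (fun_tlift (h := fun v => w * v)); last first.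
    by move=> l s t; rewrite mulrDr scalerAr.
  by apply: eq_tlift => a b; rewrite (linZ _ _ lS) -scalerAr scalerAl.
move=> ->; under eq_tlift => c1 c2.
  rewrite tlift_tlift; under eq_tlift => d1 d2.
    rewrite tliftE // /F tliftE; last by apply: (bilin_comp (bilin_mul H)).
    rewrite -mulrA; over.
  rewrite -(fun_tlift (h := fun v => L c1 * v)); last exact: mull_is_linear.
  rewrite antipoder -scalerAr mulr1 -(linZ _ _ lL); over.
by rewrite -(fun_tlift _ _ lL) counitr.
Qed.

Lemma antipode_mulg g u : antipode (glval g * u) = antipode u * glval g^-1%g.
Proof.
have lmul := mull_is_linear (glval g).
have lS := @antipode_is_linear K H; have bS := antipode_bilinl H.
rewrite -[LHS]mulr1 -(glval_mulV g) mulrA; congr (_ * _).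
rewrite -[RHS]mul1r -(antipode_unique (L := fun v => antipode (glval g * v) * glval g)) //.
  by move=> l s t /=; rewrite lmul lS mulrDl scalerAl.
move=> v; have := antipodel (glval g * v); rewrite counitM (glvalP g).2 mul1r => <-.
rewrite comulM (glvalP g).1.
have -> : tmul (glval g *t glval g) (comul v) =
    tmap (fun w => glval g * w) (fun w => glval g * w) (comul v).
  move: (comul v); apply: tensor_extP => [||b c].
  - exact: tmul_linearr.
  - exact: tmap_is_linear.
  - by rewrite tmul_pure tmapE.
by rewrite tlift_tmap //; apply: eq_tlift => b c; rewrite mulrA.
Qed.

Lemma antipode_mulrg g u : antipode (u * glval g) = glval g^-1%g * antipode u.
Proof.
have lmul := mulr_is_linear (glval g).
have lS := @antipode_is_linear K H; have bS := antipode_bilinl H.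
apply: (antipode_unique (L := fun v => antipode (v * glval g))) => [|v].
  exact: comp_is_linear lS lmul.
have := antipodel (v * glval g); rewrite counitM (glvalP g).2 mulr1 comulM (glvalP g).1.
have -> : tmul (comul v) (glval g *t glval g) =
    tmap (fun w => w * glval g) (fun w => w * glval g) (comul v).
  move: (comul v); apply: tensor_extP => [||b c]; [exact: tmul_linearl | exact: tmap_is_linear|].
  by rewrite tmul_pure tmapE.
rewrite tlift_tmap // => /(congr1 (fun w => w * glval g^-1%g)).
rewrite -scalerAl mul1r => <-.
rewrite (fun_tlift (h := fun w => w * glval g^-1%g)); last exact: mulr_is_linear.
by apply: eq_tlift => b c; rewrite -!mulrA glval_mulV mulr1.
Qed.

(** Applying S(u_1) u_2 = counit(u) to u x gives S(u_1 x) u_2 g + S(u_1) u_2 x = 0, that is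
    L * id = - x g^-1 counit for L u = S(u x). *)
Lemma antipode_mul_skew (g : grouplike H) (x u : H) :
  x \in skew_primitive (glval g) 1 -> counit x = 0 ->
  antipode (u * x) = - (x * glval g^-1%g) * antipode u.
Proof.
move=> /eqP Dx ex; have lS := @antipode_is_linear K H; have bS := antipode_bilinl H.
have lmul := @mulr_is_linear K H.
have bSr (w : H) : bilin (fun b c : H => antipode (b * w) * c).
  by apply: (bilin_comp (bilin_mul H)) => //; exact: comp_is_linear lS (lmul w).
have bSl (w : H) : bilin (fun b c : H => antipode b * (c * w)).
  exact: (bilin_comp (bilin_mul H)).
apply: (antipode_unique (L := fun v => antipode (v * x))) => [|v].
  exact: comp_is_linear lS (lmul x).
have := antipodel (v * x); rewrite counitM ex mulr0 scale0r comulM Dx (linD (tmul_linearr _)).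
have tmulE (b c : H) : tmul (comul v) (b *t c) = tmap (fun w => w * b) (fun w => w * c) (comul v).
  move: (comul v); apply: tensor_extP => [||b' c']; [exact: tmul_linearl | exact: tmap_is_linear|].
  by rewrite tmul_pure tmapE.
rewrite !tmulE (linD (tlift_is_linear _)) !tlift_tmap // => /(congr1 (fun w => w * glval g^-1%g)).
rewrite mul0r mulrDl => /eqP; rewrite addr_eq0.
rewrite (fun_tlift (h := fun w => w * glval g^-1%g)) //; under eq_tlift => b c.
  rewrite -!mulrA glval_mulV mulr1; over.
move/eqP => ->; under [in LHS]eq_tlift => b c.
  rewrite mulr1 mulrA; over.
rewrite -(fun_tlift (h := fun w => w * x)) // antipodel -!scalerAl mul1r scalerN.
by [].
Qed.

End Antipode.

(** * Powers of a skew primitive element *)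

Section SkewPrimitivePowers.
Variables (k : fieldType) (H : hopfType k) (a : grouplike H) (x : H) (q : k).
Hypotheses (pointed_H : pointed H) (Px : x \in skew_primitive (glval a) 1).
Hypotheses (q_neq0 : q != 0) (eigen_x : conj_by a x = q *: x).
Implicit Types (g h : grouplike H) (m i j s t : nat).

(** The basis vectors of a Poincare-Birkhoff-Witt basis, as long as i is below the
    degree of x. *)
Definition pbw g i : H := glval g * x ^+ i.

Lemma mul_glval_pbw g h i : glval g * pbw h i = pbw (g * h)%g i.
Proof. by rewrite /pbw glvalM mulrA. Qed.

Lemma pbw_mulx g i : pbw g i * x = pbw g i.+1.
Proof. by rewrite /pbw exprSr mulrA. Qed.

Lemma commute_eigen : glval a * x = q *: (x * glval a).
Proof.
by rewrite scalerAl -eigen_x /conj_by divrK ?glval_unit.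
Qed.

Lemma expr_mul_glval i : x ^+ i * glval a = q^-1 ^+ i *: (glval a * x ^+ i).
Proof.
elim: i => [|i IHi]; first by rewrite !expr0 mul1r mulr1 scale1r.
rewrite [x ^+ _]exprS -mulrA IHi -scalerAr !mulrA.
have -> : x * glval a = q^-1 *: (glval a * x) by rewrite commute_eigen scalerA mulVf // scale1r.
by rewrite -scalerAl scalerA -exprSr.
Qed.

(** The q-binomial theorem for comul x = B + A with B = x (x) a and A = 1 (x) x, where
    A B = q^-1 B A. *)
Lemma comul_pbw g i : comul (pbw g i) =
  \sum_(j < i.+1) gbin q^-1 i j *: (pbw g (i - j) *t pbw (g * a ^+ (i - j))%g j).
Proof.
have [Dg _] := glvalP g; move/eqP: Px => Dx.
elim: i => [|i IHi].
  by rewrite big_ord1 subn0 /pbw expg0 mulg1 expr0 mulr1 Dg scale1r.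
rewrite -pbw_mulx comulM IHi Dx (lin_sum _ _ _ (tmul_linearl _)).
transitivity (\sum_(j < i.+1) gbin q^-1 i j *:
   (q^-1 ^+ j *: (pbw g (i.+1 - j) *t pbw (g * a ^+ (i.+1 - j))%g j)
    + pbw g (i - j) *t pbw (g * a ^+ (i - j))%g j.+1)).
  apply: eq_bigr => j _; rewrite (linZ _ _ (tmul_linearl _)); congr (_ *: _).
  rewrite (linD (tmul_linearr _)) !tmul_pure mulr1 !pbw_mulx.
  rewrite subSn ?(ltnSE (ltn_ord j)) //; congr (_ + _).
  rewrite -(bilinZr _ _ _ (bilin_tpure _ _)); congr (_ *t _).
  by rewrite /pbw -mulrA expr_mul_glval -scalerAr mulrA -glvalM -mulgA -expgSr.
under eq_bigr => j _ do rewrite scalerDr scalerA.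
rewrite big_split /= [RHS]big_ord_recl gbin0 !subn0.
under [X in _ = _ + X]eq_bigr => j _.
  rewrite lift0 subSS gbinS scalerDl; over.
rewrite big_split /= addrCA [LHS]addrC; congr (_ + _).
rewrite big_ord_recl gbin0 expr0 mulr1 subn0; congr (_ + _).
rewrite [RHS]big_ord_recr /= gbin_small // mulr0 scale0r addr0.
by apply: eq_bigr => j _; rewrite /bump /= add1n subSS mulrC.
Qed.

Lemma below_degree_sub m (U : {vspace H}) :
  (forall g i, (i < m)%N -> pbw g i \in U) -> (below_degree m x <= U)%VS.
Proof.
move=> pbwU; apply/subv_sumP=> i _; apply/prodvP=> y z y0 /vlineP[l ->].
case/(mem_coradicalP pointed_H): y0 => c ->.
rewrite mulr_suml; apply: rpred_sum => g _.
by rewrite -scalerAl -scalerAr !memvZ // pbwU.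
Qed.

Lemma pbw_below m g i : (i < m)%N -> pbw g i \in below_degree m x.
Proof.
move=> lt_im; rewrite /below_degree (subvP (sumv_sup (Ordinal lt_im) _ (subvv _))) //.
by rewrite memv_mul ?glval_coradical ?memv_line.
Qed.

Lemma below_degree_mono m n : (m <= n)%N -> (below_degree m x <= below_degree n x)%VS.
Proof.
by move=> le_mn; apply: below_degree_sub => g i lt_im; apply/pbw_below/(leq_trans lt_im).
Qed.

Lemma below_degreeP m y :
  reflect (exists c : grouplike H -> nat -> k, y = \sum_g \sum_(i < m) c g i *: pbw g i)
          (y \in below_degree m x).
Proof.
apply: (iffP idP) => [|[c ->]]; last first.
  by apply: rpred_sum => g _; apply: rpred_sum => i _; rewrite memvZ // pbw_below.
suff /subvP sub : (below_degree m x <=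
    \sum_(gi : grouplike H * 'I_m) <[pbw gi.1 gi.2]>)%VS.
  move=> /sub/mem_sum_linesP[c ->].
  exists (fun g i => oapp (fun i' : 'I_m => c (g, i')) 0 (insub i)).
  by rewrite [RHS]pair_bigA /=; apply: eq_bigr => [[g i]] _ /=; rewrite valK.
apply: below_degree_sub => g i lt_im.
by rewrite memvE (sumv_sup (g, Ordinal lt_im)).
Qed.

Lemma below_degree_ext (V : vectType k) m (f1 f2 : H -> V) : linear f1 -> linear f2 ->
  (forall g i, (i < m)%N -> f1 (pbw g i) = f2 (pbw g i)) ->
  {in below_degree m x, f1 =1 f2}.
Proof.
move=> l1 l2 f12 y /below_degreeP[c ->]; rewrite !lin_sum //; apply: eq_bigr => g _.
by rewrite !lin_sum //; apply: eq_bigr => i _; rewrite !linZ // f12.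
Qed.

Lemma below_degree_mull m g y :
  y \in below_degree m x -> glval g * y \in below_degree m x.
Proof.
case/below_degreeP=> c ->; rewrite mulr_sumr; apply: rpred_sum => h _.
rewrite mulr_sumr; apply: rpred_sum => i _.
by rewrite -scalerAr memvZ // mul_glval_pbw pbw_below.
Qed.

(** The contractions c |-> phi(c_1) c_2 preserve below_degree m x. If y = h x^m with
    h = sum_g c_g g lies there, then contracting with the functional dual to g
    leaves c_g g x^m modulo below_degree m x, so that c_g = 0. *)
Lemma coradical_mul_expr_inj m (c : grouplike H -> k) :
  x ^+ m \notin below_degree m x ->
  \sum_g c g *: pbw g m \in below_degree m x -> forall g, c g = 0.
Proof.
move=> xm ym g; set y := \sum_g _ in ym.
have [phi [lphi phiE]] := glval_dual H.
pose f (y : H) := tlift (fun u v => (phi g u : k) *: v) (comul y).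
have bphi : bilin (fun u v : H => (phi g u : k) *: v).
  by split=> w l u v; rewrite ?lphi ?scalerDl ?scalerDr !scalerA // mulrC.
have lf : linear f by exact: comp_is_linear (tlift_is_linear _) (@comul_is_linear k H).
have fE h i : f (pbw h i) = \sum_(j < i.+1)
    (gbin q^-1 i j * (phi g (pbw h (i - j)) : k)) *: pbw (h * a ^+ (i - j))%g j.
  rewrite /f comul_pbw (lin_sum _ _ _ (tlift_is_linear _)); apply: eq_bigr => j _.
  by rewrite (linZ _ _ (tlift_is_linear _)) tliftE // scalerA.
have [U UE] := linear_preim (below_degree m x) lf.
have /subvP/(_ _ ym) : (below_degree m x <= U)%VS.
  apply: below_degree_sub => h i lt_im; rewrite UE fE; apply: rpred_sum => j _.
  by rewrite memvZ // pbw_below // (leq_trans (ltn_ord j)).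
rewrite UE /y (lin_sum _ _ _ lf).
under eq_bigr => h _ do rewrite (linZ _ _ lf) fE big_ord_recr /= subnn gbinnn mul1r scalerDr.
rewrite big_split /= rpredDl; last first.
  apply: rpred_sum => h _; rewrite memvZ //; apply: rpred_sum => j _.
  by rewrite memvZ // pbw_below.
rewrite (bigD1 g) //= {1}/pbw expr0 mulr1 phiE eqxx scale1r expg0 mulg1 big1 => [|h ne_hg].
  rewrite addr0; have [//|cg_neq0] := eqVneq (c g) 0.
  rewrite rpredZeq (negPf cg_neq0) /= => /(below_degree_mull g^-1%g).
  by rewrite /pbw mulrA glval_mulVl mul1r (negPf xm).
by rewrite {1}/pbw expr0 mulr1 phiE eq_sym (negPf ne_hg) scale0r scaler0.
Qed.

(** Freeness over H_0: the minimality of the degree only keeps x^i itself, and not its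
    H_0-multiples, away from the lower terms; coradical_mul_expr_inj closes this gap. *)
Lemma pbw_indep m (c : grouplike H -> nat -> k) :
  (forall i, (i < m)%N -> x ^+ i \notin below_degree i x) ->
  \sum_g \sum_(i < m) c g i *: pbw g i = 0 -> forall g i, (i < m)%N -> c g i = 0.
Proof.
elim: m => [|m IHm] // deg_x; under eq_bigr => g _ do rewrite big_ord_recr /=.
rewrite big_split /= => /eqP; rewrite addrC addr_eq0 => /eqP e g i lt_im.
have cm : forall g, c g m = 0.
  apply: coradical_mul_expr_inj (deg_x m (ltnSn m)) _; rewrite e rpredN.
  by apply/below_degreeP; exists c.
have [->//|ne_im] := eqVneq i m.
apply: IHm => [j lt_jm||]; first by apply: deg_x; apply: ltnW.
  apply/eqP; rewrite -oppr_eq0 -e; apply/eqP; apply: big1 => h _.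
  by rewrite cm scale0r.
by rewrite ltn_neqAle ne_im -ltnS.
Qed.

Lemma pbw_dual m : (forall i, (i < m)%N -> x ^+ i \notin below_degree i x) ->
  exists phi : grouplike H -> nat -> H -> k^o,
    (forall g i, linear (phi g i)) /\
    forall g i h j, (j < m)%N -> phi g i (pbw h j) = ((g == h) && (i == j))%:R.
Proof.
move=> deg_x; pose v (gi : grouplike H * 'I_m) := pbw gi.1 gi.2.
have [|phi [lphi phiE]] := @dual_family _ _ _ v.
  move=> c c0 [g i].
  pose c' (h : grouplike H) (j : nat) := oapp (fun j' : 'I_m => c (h, j')) 0 (insub j).
  have := @pbw_indep m c' deg_x _ g i (ltn_ord i); rewrite /c' valK; apply.
  rewrite -[RHS]c0 pair_bigA /=; apply: eq_bigr => [[h j]] _ /=; by rewrite valK.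
exists (fun g i => if insub i is Some i' then phi (g, i') else fun _ => 0).
split=> [g i|g i h j lt_jm]; first by case: insubP => //= _ l u w; rewrite scaler0 addr0.
case: insubP => [i' _ <-|]; first by rewrite -[pbw h j]/(v (h, Ordinal lt_jm)) phiE.
by have [->|] := eqVneq i j; rewrite ?lt_jm ?andbF.
Qed.

(** The position g x^s (x) h x^t determines the one basis vector g x^(s+t) whose coproduct
    reaches it, so a single coefficient of y survives. *)
Lemma comul_coef m (phi : grouplike H -> nat -> H -> k^o) g h s t y :
  (forall g i, linear (phi g i)) ->
  (forall g i h j, (j < m)%N -> phi g i (pbw h j) = ((g == h) && (i == j))%:R) ->
  y \in below_degree m x ->
  tlift (fun u v => phi g s u * phi h t v : k^o) (comul y) =
  if (h == g * a ^+ s)%g then gbin q^-1 (s + t) t * phi g (s + t)%N y else 0.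
Proof.
move=> lphi phiE.
have bphi : bilin (fun u v : H => phi g s u * phi h t v : k^o).
  split=> w l u v; rewrite lphi ?mulrDl ?mulrDr; congr (_ + _); first exact/esym/mulrA.
  exact: mulrCA.
move: y; apply: (@below_degree_ext k^o) => [||g' i lt_im].
- exact: comp_is_linear (tlift_is_linear _) (@comul_is_linear k H).
- case: (h == g * a ^+ s)%g => l u w; last by rewrite scaler0 addr0.
  by rewrite (lphi g (s + t)%N) mulrDr; congr (_ + _); apply: mulrCA.
rewrite comul_pbw (lin_sum _ _ _ (tlift_is_linear _)) phiE //.
under eq_bigr => j _.
  rewrite (linZ _ _ (tlift_is_linear _)) tliftE // !phiE; first over.
  - by apply: leq_trans lt_im; rewrite ltnS -ltnS.
  - by apply: leq_trans lt_im; rewrite ltnS leq_subr.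
have [st|st_neq] := eqVneq (s + t)%N i; last first.
  rewrite andbF mulr0 if_same big1 // => j _.
  have [js|] := eqVneq s (i - j)%N; last by rewrite andbF mul0r scaler0.
  have [jt|] := eqVneq t j; last by rewrite andbF mulr0 scaler0.
  by case/eqP: st_neq; rewrite js jt subnK // -ltnS.
have lt_ti : (t < i.+1)%N by rewrite ltnS -st leq_addl.
rewrite andbT (bigD1 (Ordinal lt_ti)) //= big1 ?addr0 => [|j]; last first.
  rewrite -val_eqE /= eq_sym => /negPf->; by rewrite andbF mulr0 scaler0.
rewrite -st addnK !eqxx !andbT; have [->|] := eqVneq g g'; last first.
  by rewrite mul0r scaler0 mulr0 if_same.
by case: eqP; rewrite ?mul1r ?mulr1 ?scaler0 ?mulr0 // => _; apply: mulr1.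
Qed.

Lemma bilin_mul_functional (U V : vectType k) (phi : U -> k^o) (psi : V -> k^o) :
  linear phi -> linear psi -> bilin (fun u v => phi u * psi v : k^o).
Proof.
move=> lphi lpsi; split=> w l u v; rewrite ?lphi ?lpsi ?mulrDl ?mulrDr; congr (_ + _).
- exact/esym/mulrA.
- exact: mulrCA.
Qed.

Lemma skew_primitive_expr n : (0 < n)%N ->
  (forall j, (0 < j < n)%N -> gbin q^-1 n j = 0) ->
  x ^+ n \in skew_primitive (glval (a ^+ n)%g) 1.
Proof.
case: n => // n _ mid0; apply/eqP.
have -> : x ^+ n.+1 = pbw 1%g n.+1 by rewrite /pbw mul1r.
rewrite comul_pbw big_ord_recl big_ord_recr /= big1 => [|j _].
  rewrite /bump /= add1n gbinnn gbin0 !scale1r add0r subn0 subnn /pbw !mul1g expg0 glval1.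
  by rewrite !expr0 !mulr1 !mul1r.
by rewrite /bump /= add1n mid0 ?scale0r //= ltnS ltn_ord.
Qed.

(** The term gbin n j x^(n-j) (x) a^(n-j) x^j of comul (x^n) has no counterpart in
    the coproduct of an H_0-combination of lower powers. *)
Lemma gbin_degree n j : has_degree x n -> (0 < j < n)%N -> gbin q^-1 n j = 0.
Proof.
case=> xn deg_x /andP[j_gt0 lt_jn].
have [phi [lphi phiE]] := pbw_dual deg_x.
have phin : phi 1%g n (pbw 1%g n) = 0.
  have : pbw 1%g n \in below_degree n x by rewrite /pbw mul1r.
  apply: (@below_degree_ext k^o _ (phi 1%g n) (fun=> 0)) => // [l u v|g i lt_in].
    by rewrite scaler0 addr0.
  by rewrite phiE // (gtn_eqF lt_in) andbF.
have le_jn := ltnW lt_jn.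
have := comul_coef 1%g (1 * a ^+ (n - j))%g (n - j) j lphi phiE _ .
have xn' : pbw 1%g n \in below_degree n x by rewrite /pbw mul1r.
move/(_ _ xn'); rewrite eqxx subnK // phin mulr0 comul_pbw.
have bphi g g' i i' := bilin_mul_functional (lphi g i) (lphi g' i').
have lt_njn : (n - j < n)%N by rewrite ltn_subrL j_gt0 (leq_trans _ lt_jn).
rewrite (lin_sum _ _ _ (tlift_is_linear _)) (bigD1 (Ordinal (ltnW lt_jn : (j < n.+1)%N))) //=.
rewrite big1 => [|i]; rewrite (linZ _ _ (tlift_is_linear _)) tliftE //; last first.
  rewrite -val_eqE /= => ne_ij; have [lt_in|ge_in] := ltnP i n.
    by rewrite [X in _ * X]phiE // (eq_sym j) (negPf ne_ij) andbF mulr0 scaler0.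
  have -> : (n - i = 0)%N by apply/eqP.
  by rewrite phiE ?(leq_trans _ lt_jn) // subn_eq0 leqNgt lt_jn andbF mul0r scaler0.
by rewrite !phiE // !eqxx addr0 mulr1 => e; rewrite -[LHS]mulr1.
Qed.

(** Comparing the coefficients of comul y = y (x) b + 1 (x) y at g x^s (x) h x^t:
    s = 0 < t confines the positive powers of x to g = 1; t = 0 < s gives a^s = b;
    s, t > 0 makes the Gaussian binomials vanish; s = t = 0 is the classification of
    skew primitives in the group algebra. *)
Lemma skew_primitive_below m (b : grouplike H) y :
  (0 < m)%N -> (forall i, (i < m)%N -> x ^+ i \notin below_degree i x) ->
  y \in below_degree m x -> y \in skew_primitive (glval b) 1 ->
  exists (c0 : k) (d : nat -> k),
    y = c0 *: (glval b - 1) + \sum_(i < m | (0 < i)%N) d i *: x ^+ i /\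
    forall i, (0 < i < m)%N -> d i != 0 ->
      (a ^+ i)%g = b /\ forall j, (0 < j < i)%N -> gbin q^-1 i j = 0.
Proof.
move=> m_gt0 deg_x ym /eqP Dy; have [phi [lphi phiE]] := pbw_dual deg_x.
pose c g i : k := phi g i y.
have yE : y = \sum_g \sum_(i < m) c g i *: pbw g i.
  move: y ym @c {Dy}; apply: (below_degree_ext (f1 := id)) => // [l u v|h j lt_jm].
    rewrite scaler_sumr -big_split; apply: eq_bigr => g _ /=.
    rewrite scaler_sumr -big_split; apply: eq_bigr => i _ /=.
    by rewrite lphi scalerDl scalerA.
  rewrite (bigD1 h) //= (bigD1 (Ordinal lt_jm)) //= phiE // !eqxx scale1r.
  rewrite !big1 ?addr0 // => [g ne_gh|i].
    by rewrite big1 // => i _; rewrite phiE // (negPf ne_gh) scale0r.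
  by rewrite -val_eqE /= => /negPf ne_ij; rewrite phiE // ne_ij andbF scale0r.
have coefs g h s t : (if (h == g * a ^+ s)%g then gbin q^-1 (s + t) t * c g (s + t)%N else 0) =
    c g s * ((h == b) && (t == 0)%N)%:R + ((g == 1%g) && (s == 0)%N)%:R * c h t.
  have bphi := bilin_mul_functional (lphi g s) (lphi h t).
  rewrite -(comul_coef g h s t lphi phiE ym) Dy (linD (tlift_is_linear _)) !tliftE.
  - by congr (_ * _ + _ * _); rewrite -phiE // /pbw expr0 mulr1.
  - exact: bphi.
  - exact: bphi.
have c_pos g t : g != 1%g -> (0 < t)%N -> c g t = 0.
  move=> g1 t0; have := coefs g g 0 t.
  by rewrite expg0 mulg1 eqxx add0n gbinnn mul1r (gtn_eqF t0) andbF (negPf g1) mulr0 mul0r addr0.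
have c0_b g : g != 1%g -> g != b -> c g 0%N = 0.
  move=> g1 gb; have := coefs g g 0%N 0%N.
  by rewrite expg0 mulg1 eqxx gbin0 mul1r (negPf gb) (negPf g1) mulr0 mul0r addr0.
exists (if b == 1%g then 0 else c b 0%N), (c 1%g); split; last first.
  move=> i /andP[i_gt0 lt_im] ci; split=> [|j /andP[j_gt0 lt_ji]].
    apply/eqP/negPn/negP=> ne; case/eqP: ci.
    have := coefs 1%g (a ^+ i)%g i 0%N.
    rewrite mul1g eqxx addn0 gbin0 mul1r (negPf ne) (gtn_eqF i_gt0) andbF.
    by rewrite mulr0 mul0r addr0.
  have := coefs 1%g (a ^+ (i - j))%g (i - j)%N j.
  rewrite mul1g eqxx subnK ?(ltnW lt_ji) // (gtn_eqF j_gt0) andbF mulr0 add0r.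
  rewrite subn_eq0 leqNgt lt_ji andbF mul0r => /eqP.
  by rewrite mulf_eq0 (negPf ci) orbF => /eqP.
rewrite {1}yE exchange_big /= (bigD1 (Ordinal m_gt0)) //=; congr (_ + _); last first.
  rewrite big_mkcond [RHS]big_mkcond; apply: eq_bigr => i _ /=.
  rewrite -val_eqE /= lt0n; case: eqP => //= /eqP i0.
  rewrite (bigD1 1%g) //= big1 ?addr0 => [|g g1]; first by rewrite /pbw mul1r.
  by rewrite c_pos ?scale0r // lt0n.
have pbw0 g : pbw g 0 = glval g by rewrite /pbw expr0 mulr1.
have := coefs 1%g b 0%N 0%N; rewrite expg0 mulg1 gbin0 !eqxx !mul1r mulr1.
rewrite (bigD1 1%g) //= pbw0; have [b1|b1] := eqVneq b 1%g.
  rewrite b1 => /eqP; rewrite -subr_eq0 opprD addrA subrr add0r oppr_eq0 => /eqP ->.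
  rewrite !scale0r add0r big1 // => g g1.
  by rewrite c0_b ?scale0r ?b1.
move/esym/eqP; rewrite addr_eq0 => /eqP ->; rewrite (bigD1 b) //= pbw0 big1 => [|g /andP[g1 gb]].
  by rewrite addr0 scaleNr scalerBr addrC.
by rewrite c0_b ?scale0r.
Qed.

End SkewPrimitivePowers.

Section Degree.
Variables (k : fieldType) (H : hopfType k) (x : H).
Hypothesis pointed_H : pointed H.

Lemma below_degree1 : below_degree 1 x = coradical H.
Proof. by rewrite /below_degree big_ord1 expr0 prodv1. Qed.

Lemma degree_gt1 n : x \notin coradical H -> has_degree x n -> (1 < n)%N.
Proof.
case: n => [|[|//]] xH0 [xn _]; last by rewrite -below_degree1 -[x]expr1 xn in xH0.
by move: xn; rewrite /below_degree big_ord0 expr0 memv0 oner_eq0.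
Qed.

(** Otherwise the dimension of below_degree m x would grow with m without bound. *)
Lemma degree_exists : exists n, has_degree x n.
Proof.
pose P n := x ^+ n \in below_degree n x.
have dim_below m : (forall i, (i < m)%N -> ~~ P i) -> (m <= \dim (below_degree m x))%N.
  elim: m => // m IHm nP; apply: leq_ltn_trans (IHm _) _ => [i /ltnW/nP //|].
  have sub := below_degree_mono x pointed_H (leqnSn m).
  rewrite ltn_neqAle dimvS // andbT; apply/negP=> dimE; case/negP: (nP m (ltnSn m)).
  have /eqP e : below_degree m x == below_degree m.+1 x by rewrite eqEdim sub (eqP dimE) /=.
  rewrite /P e.
  by rewrite -[x ^+ m]mul1r -[1]/(glval 1%g : H); apply: pbw_below.
have exP : exists n, P n.
  apply: contrapT => /forallNP nP; have := dim_below (\dim {:H}).+1 (fun i _ => introN idP (nP i)).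
  by rewrite leqNgt ltnS dimvS ?subvf.
exists (ex_minn exP); case: ex_minnP => n Pn min_n; split=> // m lt_mn.
by apply/negP=> Pm; have := min_n m Pm; rewrite leqNgt lt_mn.
Qed.

End Degree.

Lemma primitive_rootV (F : fieldType) n (z : F) : n.-primitive_root z -> n.-primitive_root z^-1.
Proof.
case/andP=> n_gt0 /forallP z_prim; rewrite /primitive_root_of_unity n_gt0.
by apply/forallP=> i; rewrite -(eqP (z_prim i)) !unity_rootE exprVn invr_eq1.
Qed.

(** * The relation satisfied by the top power *)

Section PowerOfDegree.
Variables (k : fieldType) (p : nat) (H : hopfType k) (a : grouplike H) (x : H).
Variables (q : k) (N : nat).
Hypotheses (char_k : p \in [pchar k]) (pointed_H : pointed H).
Hypotheses (Px : x \in skew_primitive (glval a) 1) (x_notin_H0 : x \notin coradical H).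
Hypotheses (prim_q : N.-primitive_root q) (eigen_x : conj_by a x = q *: x).

Lemma primitive_root_neq0 : q != 0.
Proof.
apply/eqP=> q0; have := prim_expr_order prim_q; rewrite q0 expr0n.
by rewrite gtn_eqF ?(prim_order_gt0 prim_q) // => /eqP; rewrite eq_sym oner_eq0.
Qed.
Let q_neq0 := primitive_root_neq0.
Let primV := primitive_rootV prim_q.

Lemma skew_neq0 : x != 0.
Proof. by apply: contra x_notin_H0 => /eqP->; apply: mem0v. Qed.

Lemma glval_expr_mul n : glval a ^+ n * x = q ^+ n *: (x * glval a ^+ n).
Proof.
elim: n => [|n IHn]; first by rewrite !expr0 mul1r mulr1 scale1r.
rewrite [glval a ^+ _]exprS -mulrA IHn -scalerAr !mulrA (commute_eigen eigen_x) -scalerAl scalerA.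
by rewrite -exprSr.
Qed.

Lemma dvdn_order_skew n : (a ^+ n = 1)%g -> (N %| n)%N.
Proof.
move=> an; have := glval_expr_mul n; rewrite -glvalX an glval1 mul1r mulr1 => /eqP.
rewrite -subr_eq0 -{1}[x]scale1r -scalerBl scaler_eq0 (negPf skew_neq0) orbF subr_eq0.
by rewrite (prim_order_dvd prim_q) eq_sym.
Qed.

(** The middle terms of comul (x^n) vanish, so that n = N p^r and x^n is skew primitive.
    By the shape of skew primitives x^n = c (a^n - 1) + sum_i d_i x^i, where d_i <> 0 forces
    a^i = a^n; then conjugation by a^(n-i) = 1 fixes x, so that N divides
    n - i and i, and again the Gaussian binomials of row i vanish, so that i = N p^s. *)
Lemma expr_degree n : has_degree x n ->
  exists r : nat, n = (N * p ^ r)%N /\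
  exists (alpha_m1 : k) (alpha : 'I_r -> k),
    x ^+ n = alpha_m1 *: (glval a ^+ n - 1) + \sum_(i < r) alpha i *: x ^+ (N * p ^ i) /\
    forall i : 'I_r, glval a ^+ (N * (p ^ r - p ^ i)) <> 1 -> alpha i = 0.
Proof.
move=> deg_n; have n_gt1 := degree_gt1 x_notin_H0 deg_n; have n_gt0 := ltnW n_gt1.
have p_pr := pcharf_prime char_k; have N_gt0 := prim_order_gt0 prim_q.
have mid0 := gbin_degree pointed_H Px q_neq0 eigen_x deg_n.
have [n1|[r ne]] := gbin_row_eq0 char_k primV n_gt0 (fun j => @mid0 j).
  by rewrite n1 in n_gt1.
have an_x := skew_primitive_expr Px q_neq0 eigen_x n_gt0 (fun j => @mid0 j).
have [xn deg_x] := deg_n.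
have [c [d [xnE dP]]] := skew_primitive_below pointed_H Px q_neq0 eigen_x n_gt0 deg_x xn an_x.
have dE i : (0 < i < n)%N -> d i != 0 -> exists2 s, i = (N * p ^ s)%N & (s < r)%N.
  move=> i_n di; have /andP[i_gt0 lt_in] := i_n; have [ai row0] := dP i i_n di.
  have Nni : (N %| n - i)%N.
    apply: dvdn_order_skew; apply: (mulgI (a ^+ i)%g).
    by rewrite -expgnDr subnKC ?(ltnW lt_in) // mulg1.
  have Ni : (N %| i)%N by rewrite -(dvdn_addr _ Nni) subnK ?(ltnW lt_in) // ne dvdn_mulr.
  have [s ie] : exists s, i = (N * p ^ s)%N.
    have [i1|//] := gbin_row_eq0 char_k primV i_gt0 (fun j => @row0 j).
    by exists 0%N; move: Ni; rewrite i1 dvdn1 => /eqP ->.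
  exists s => //; move: lt_in; rewrite ie ne ltn_pmul2l // ltn_exp2l // prime_gt1 //.
exists r; split=> //; exists c, (fun s => d (N * p ^ s)%N); split=> [|s a_neq1]; last first.
  apply/eqP/negPn/negP=> ds; apply: a_neq1.
  have lt_sn : (N * p ^ s < n)%N by rewrite ne ltn_pmul2l // ltn_exp2l ?prime_gt1 ?ltn_ord.
  have [|as_n _] := dP (N * p ^ s)%N _ ds.
    by rewrite muln_gt0 N_gt0 expn_gt0 prime_gt0.
  rewrite mulnBr -ne -glvalX; suff -> : (a ^+ (n - N * p ^ s) = 1)%g by [].
  by apply: (mulgI (a ^+ (N * p ^ s))%g); rewrite -expgnDr subnKC ?(ltnW lt_sn) // mulg1.
rewrite {1}xnE glvalX; congr (_ + _).
transitivity (\sum_(i < n | (0 < i)%N) \sum_(s < r | (N * p ^ s == i)%N) d i *: x ^+ i).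
  apply: eq_bigr => i i_gt0; have [->|di] := eqVneq (d i) 0.
    by rewrite scale0r big1 // => s _; rewrite scale0r.
  have [|s ie lt_sr] := dE i _ di; first by rewrite i_gt0 ltn_ord.
  rewrite (big_pred1 (Ordinal lt_sr)) // => s' /=.
  by rewrite ie eqn_pmul2l // eqn_exp2l ?prime_gt1 // -val_eqE.
rewrite (exchange_big_dep predT) //=; apply: eq_bigr => s _.
have lt_sn : (N * p ^ s < n)%N by rewrite ne ltn_pmul2l // ltn_exp2l ?prime_gt1 ?ltn_ord.
rewrite (big_pred1 (Ordinal lt_sn)) // => i /=.
rewrite -val_eqE /= [in RHS]eq_sym; case: eqP => [<-|_]; rewrite ?andbF //.
by rewrite muln_gt0 N_gt0 expn_gt0 prime_gt0.
Qed.

End PowerOfDegree.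

(** * The first coradical layer in rank one *)

Section Wedge.
Variables (k : fieldType) (H : hopfType k).
Hypothesis pointed_H : pointed H.
Implicit Types (g h b : grouplike H) (y : H).

Local Notation H0 := (coradical H).
Local Notation wedge := (tensorv fullv (coradical H) + tensorv (coradical H) fullv)%VS.

Lemma mem_coradical1 y : (y \in coradical1 H) = (comul y \in wedge).
Proof. by rewrite /coradical1 -memv_preim lfunE. Qed.

Lemma tpure_wedgel u h : u *t glval h \in wedge.
Proof. by rewrite (subvP (addvSl _ _)) // mem_tensorv ?memvf ?glval_coradical. Qed.

Lemma tpure_wedger h v : glval h *t v \in wedge.
Proof. by rewrite (subvP (addvSr _ _)) // mem_tensorv ?memvf ?glval_coradical. Qed.

(** As H_0 is spanned by group-likes, computations with H_1 modulo H_0 reduce to pure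
    tensors with one group-like leg. *)
Lemma wedge_sub (W : vectType k) (U : {vspace W}) (f : tensor H H -> W) : linear f ->
  (forall u h, f (u *t glval h) \in U) -> (forall h v, f (glval h *t v) \in U) ->
  forall t, t \in wedge -> f t \in U.
Proof.
move=> lf fl fr t; have [U' U'E] := linear_preim U lf; rewrite -U'E; apply/subvP: t.
rewrite subv_add; apply/andP; split; apply: vspan_sub => _ [u [v [uU vU ->]]]; rewrite U'E.
  case/(mem_coradicalP pointed_H): vU => c ->.
  rewrite (bilin_sumr _ _ _ _ (bilin_tpure _ _)) (lin_sum _ _ _ lf); apply: rpred_sum => h _.
  by rewrite (bilinZr _ _ _ (bilin_tpure _ _)) (linZ _ _ lf) memvZ.
case/(mem_coradicalP pointed_H): uU => c ->.
rewrite (bilin_suml _ _ _ _ (bilin_tpure _ _)) (lin_sum _ _ _ lf); apply: rpred_sum => h _.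
by rewrite (bilinZl _ _ _ (bilin_tpure _ _)) (linZ _ _ lf) memvZ.
Qed.

Lemma glval_coradical1 g : glval g \in coradical1 H.
Proof. by rewrite mem_coradical1 (glvalP g).1 tpure_wedgel. Qed.

Lemma skew_coradical1 b y : y \in skew_primitive (glval b) 1 -> y \in coradical1 H.
Proof.
by move/eqP=> Dy; rewrite mem_coradical1 Dy rpredD ?tpure_wedgel // -(glval1 H) tpure_wedger.
Qed.

Lemma counit_skew b y : y \in skew_primitive (glval b) 1 -> counit y = 0.
Proof.
move/eqP=> Dy; have := counitr y; rewrite Dy (linD (tlift_is_linear _)).
have bs := bilin_counit H.
rewrite !tliftE // (glvalP b).2 scale1r => /eqP; rewrite addrC -subr_eq0 addrK.
by rewrite scaler_eq0 oner_eq0 orbF => /eqP.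
Qed.

Variable phi : grouplike H -> H -> k^o.
Hypotheses (lphi : forall g, linear (phi g)) (phiE : forall g h, phi g (glval h) = (g == h)%:R).

(** The functional phi g is dual to g. Modulo H_0, the coproduct makes H_1 a graded space
    over the set of group-likes: hcomp g y is the component of y in degree g, and htrans y
    moves all components to degree 1. *)
Definition tcomp g (t : tensor H H) : H := tlift (fun u v => (phi g v : k) *: u) t.
Definition hcomp g y : H := tcomp g (comul y).
Definition ttrans (t : tensor H H) : H := \sum_g glval g^-1%g * tcomp g t.
Definition htrans y : H := ttrans (comul y).

Lemma tcomp_bilin (W : vectType k) g : bilin (fun (u : W) (v : H) => (phi g v : k) *: u).
Proof. by split=> w l u v; rewrite ?lphi ?scalerDl ?scalerDr !scalerA // mulrC. Qed.

Lemma tcompE g u v : tcomp g (u *t v) = (phi g v : k) *: u.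
Proof. by rewrite /tcomp tliftE //; apply: tcomp_bilin. Qed.

Lemma tcomp_linear g : linear (tcomp g). Proof. exact: tlift_is_linear. Qed.
Lemma hcomp_linear g : linear (hcomp g).
Proof. exact: comp_is_linear (tcomp_linear g) (@comul_is_linear k H). Qed.

Lemma ttrans_linear : linear ttrans.
Proof. by apply: sum_is_linear => g; exact: comp_is_linear (mull_is_linear _) (tcomp_linear g). Qed.

Lemma htrans_linear : linear htrans.
Proof. exact: comp_is_linear ttrans_linear (@comul_is_linear k H). Qed.

Lemma ttransl u h : ttrans (u *t glval h) = glval h^-1%g * u.
Proof.
rewrite /ttrans (bigD1 h) //= tcompE phiE eqxx scale1r big1 ?addr0 // => g gh.
by rewrite tcompE phiE (negPf gh) scale0r mulr0.
Qed.

Lemma ttransr h v : ttrans (glval h *t v) \in H0.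
Proof.
apply: rpred_sum => g _; rewrite tcompE -scalerAr memvZ // -glvalM.
exact: glval_coradical.
Qed.

Lemma htrans_skew b y : y \in skew_primitive (glval b) 1 -> htrans y - glval b^-1%g * y \in H0.
Proof.
move/eqP=> Dy; rewrite /htrans Dy (linD ttrans_linear) ttransl addrC addKr.
by rewrite -(glval1 H) ttransr.
Qed.

(** Multiplying by h shifts the degrees by h, which the translation to degree 1 undoes. *)
Lemma htrans_mull h y : y \in coradical1 H -> htrans (glval h * y) - htrans y \in H0.
Proof.
rewrite mem_coradical1 /htrans comulM (glvalP h).1 => yW.
apply: (wedge_sub (f := fun t => ttrans (tmul (glval h *t glval h) t) - ttrans t)) yW => [|u g|g v].
- by apply: sub_is_linear ttrans_linear; exact: comp_is_linear ttrans_linear (tmul_linearr _).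
- rewrite tmul_pure -glvalM !ttransl mulrA -glvalM invMg -mulgA mulVg mulg1 subrr.
  exact: mem0v.
- by rewrite tmul_pure -glvalM rpredB ?ttransr.
Qed.

(** On H_0 the functionals phi g add up to the counit. *)
Lemma hcomp_sum y : y \in coradical1 H -> y - \sum_g hcomp g y \in H0.
Proof.
rewrite mem_coradical1 -{2}[y]counitr => yW.
have bs := bilin_counit H.
apply: (wedge_sub (f := fun t => tlift (fun c1 c2 => counit c2 *: c1) t - \sum_g tcomp g t)) yW.
- exact: sub_is_linear (tlift_is_linear _) (sum_is_linear tcomp_linear).
- move=> u h; rewrite tliftE // (glvalP h).2 scale1r (bigD1 h) //= tcompE phiE eqxx scale1r.
  rewrite big1 ?addr0 ?subrr ?mem0v // => g gh.
  by rewrite tcompE phiE (negPf gh) scale0r.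
move=> h v; rewrite tliftE // rpredB ?memvZ ?glval_coradical //.
by apply: rpred_sum => g _; rewrite tcompE memvZ ?glval_coradical.
Qed.

(** Coassociativity: contracting the last leg of y_1 (x) y_2 (x) y_3 is both the coproduct of
    the contraction of y and the contraction of the second leg of comul y. *)
Lemma comul_hcomp g y : comul (hcomp g y) = tmap id (hcomp g) (comul y).
Proof.
have := congr1 (tlift (fun (s : tensor H H) v => (phi g v : k) *: s)) (comulA y).
rewrite !tlift_tlift /hcomp /tcomp (fun_tlift _ _ (@comul_is_linear k H)) /tmap.
under eq_tlift => u v.
  rewrite tliftE; last exact: tcomp_bilin.
  rewrite -(linZ _ _ (@comul_is_linear k H)); over.
move=> ->; apply: eq_tlift => u v; rewrite tlift_tlift.
rewrite (fun_tlift (h := fun w => u *t w)); last exact: tpure_linearr.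
apply: eq_tlift => c d; rewrite tliftE; last exact: tcomp_bilin.
by rewrite (bilinZr _ _ _ (bilin_tpure _ _)).
Qed.

Lemma hcomp_glval g h : hcomp g (glval h) = ((g == h)%:R : k) *: glval h.
Proof. by rewrite /hcomp (glvalP h).1 tcompE phiE. Qed.

Lemma hcomp_coradical1 g y : y \in coradical1 H -> hcomp g y \in coradical1 H.
Proof.
rewrite !mem_coradical1 comul_hcomp; have lg := hcomp_linear g.
apply: wedge_sub => [|u h|h v]; first exact: tmap_is_linear.
  by rewrite tmapE // hcomp_glval (bilinZr _ _ _ (bilin_tpure _ _)) memvZ ?tpure_wedgel.
by rewrite tmapE // tpure_wedger.
Qed.

(** The component hcomp g y is homogeneous of degree g: contracting the second leg of comul y
    with phi g keeps of a group-like h only its multiple by phi g h. *)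
Lemma htrans_hcomp g y : y \in coradical1 H ->
  htrans (hcomp g y) - glval g^-1%g * hcomp g y \in H0.
Proof.
rewrite mem_coradical1 /htrans comul_hcomp /hcomp; have lg := hcomp_linear g.
apply: (wedge_sub (f := fun t => ttrans (tmap id (hcomp g) t) - glval g^-1%g * tcomp g t))
  => [|u h|h v].
- apply: sub_is_linear; first exact: comp_is_linear ttrans_linear (tmap_is_linear _ _).
  exact: comp_is_linear (mull_is_linear _) (tcomp_linear g).
- rewrite tmapE // hcomp_glval (bilinZr _ _ _ (bilin_tpure _ _)) (linZ _ _ ttrans_linear).
  rewrite ttransl tcompE phiE.
  case: eqP => [->|_]; first by rewrite !scale1r subrr mem0v.
  by rewrite !scale0r mulr0 subrr mem0v.
- by rewrite tmapE // tcompE -scalerAr rpredB ?ttransr ?memvZ // -glvalM glval_coradical.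
Qed.

End Wedge.

Section RankOne.
Variables (k : fieldType) (H : hopfType k) (a : grouplike H) (x : H).
Hypotheses (pointed_H : pointed H) (Px : x \in skew_primitive (glval a) 1).
Hypotheses (x_notin_H0 : x \notin coradical H) (rank1 : has_rank H 1).

Local Notation H0 := (coradical H).

(** Three vectors of the two-dimensional space k (x)_(H_0) H_1 are dependent. *)
Lemma rank1_dependent (y : H) : y \in coradical1 H ->
  exists c : 'I_3 -> k, (exists i, c i != 0) /\
    \sum_i c i *: ((1 : k^o) *t [:: 1; x; y]`_i) \in balancing H.
Proof.
move=> y1; pose W := tensorv (fullv : {vspace k^o}) (coradical1 H).
pose w (i : 'I_3) : tensor k^o H := (1 : k^o) *t [:: 1; x; y]`_i.
have wW i : w i \in W.
  apply: mem_tensorv; first exact: memvf.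
  case: i => [[|[|[|]]] //= _]; [exact: (glval_coradical1 1%g) | exact: skew_coradical1 Px].
pose X := [tuple addv_pi1 W (balancing H) (w i) | i < 3].
have XE (j : 'I_3) : X`_j = addv_pi1 W (balancing H) (w j) by rewrite -tnth_nth tnth_mktuple.
have nX : ~~ free X.
  rewrite /free size_tuple; suff : (\dim <<X>> <= 2)%N by case: (\dim _) => [|[|[|]]].
  have dimQ : \dim (W :\: balancing H) = 2 := rank1.
  apply: leq_trans (eq_leq dimQ); apply/dimvS/span_subvP => _ /mapP[i _ ->].
  exact: memv_pi.
have /existsNP[c /not_implyP[c0 /existsNP[i /eqP ci]]] := elimN freeP nX.
exists c; split; first by exists i.
set z := \sum_i _; have zW : z \in W by apply: rpred_sum => j _; rewrite memvZ ?wW.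
rewrite -(addv_pi1_pi2 (subvP (addvSl W (balancing H)) _ zW)).
suff -> : addv_pi1 W (balancing H) z = 0 by rewrite add0r memv_pi2.
rewrite -[RHS]c0 linear_sum; apply: eq_bigr => j _.
by rewrite linearZ XE.
Qed.

(** Both the counit and htrans modulo H_0 factor through k (x)_(H_0) H_1; they separate the
    classes of 1 and x, which are therefore a basis. *)
Lemma htrans_rank1 phi (lphi : forall g : grouplike H, linear (phi g : H -> k^o))
    (phiE : forall g h : grouplike H, phi g (glval h) = (g == h)%:R) y :
  y \in coradical1 H -> exists c : k, htrans phi y - c *: (glval a^-1%g * x) \in H0.
Proof.
move=> y1; have [c [[i ci] cB]] := rank1_dependent y1.
have lT := htrans_linear phi.
have bT : bilin (fun (l : k^o) (m : H) => (l : k) *: htrans phi m).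
  split=> w l u v; first by rewrite scalerDl scalerA.
  by rewrite lT scalerDr !scalerA mulrC.
have beps : bilin (fun (l : k^o) (m : H) => (l * counit m : k^o)).
  split=> w l u v; first by rewrite mulrDl; congr (_ + _); apply/esym/mulrA.
  by rewrite counit_is_scalar mulrDr; congr (_ + _); apply: mulrCA.
have lf := tlift_is_linear (fun (l : k^o) (m : H) => (l : k) *: htrans phi m).
have le := tlift_is_linear (fun (l : k^o) (m : H) => (l * counit m : k^o)).
have T1 : htrans phi 1 \in H0 by rewrite /htrans comul1 -(glval1 H) (ttransr lphi).
have Tx := htrans_skew lphi phiE Px.
have a_ai := glval_mulV a; move: (glval a^-1%g) => ai in Tx a_ai *.
have [U UE] := linear_preim H0 lf.
have [U' U'E] := linear_preim (0%VS : {vspace k^o}) le.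
have cU : \sum_i c i *: ((1 : k^o) *t [:: 1; x; y]`_i) \in U.
  apply/subvP: cB; apply: vspan_sub => _ [l [h [m [hH0 m1 ->]]]]; rewrite UE.
  rewrite (linB lf) !tliftE //; case/(mem_coradicalP pointed_H): hH0 => d ->.
  have lc : linear (counit : H -> k^o) := @counit_is_scalar k H.
  rewrite (lin_sum _ _ _ lc) mulr_suml (lin_sum _ _ _ lT) mulr_sumr scaler_suml scaler_sumr -sumrB.
  apply: rpred_sum => g _.
  have -> : counit (d g *: glval g) = d g by rewrite (linZ _ _ lc) (glvalP g).2; apply: mulr1.
  rewrite -scalerAl (linZ _ _ lT).
  by rewrite scalerA -scalerBr memvZ // -opprB rpredN (htrans_mull pointed_H).
have cU' : \sum_i c i *: ((1 : k^o) *t [:: 1; x; y]`_i) \in U'.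
  apply/subvP: cB; apply: vspan_sub => _ [l [h [m [_ _ ->]]]]; rewrite U'E.
  by rewrite (linB le) !tliftE // counitM mulrA subrr mem0v.
move: cU cU'; rewrite UE U'E !big_ord_recl big_ord0 addr0 /=.
rewrite !(linD lf) !(linZ _ _ lf) !(tliftE _ _ bT) !(linD le) !(linZ _ _ le) !(tliftE _ _ beps).
rewrite !scale1r !mul1r counit1 (counit_skew Px) memv0 scaler0 add0r.
rewrite (rpredDl _ (memvZ _ T1)).
set c0 := c ord0; set c2 := c (lift ord0 (lift ord0 ord0)); set c1 := c (lift ord0 ord0).
move=> cT /eqP ce.
have [c2_eq0|c2_neq0] := eqVneq c2 0; last first.
  exists (- (c1 / c2)).
  have := memvZ c2^-1 cT; rewrite scalerDr !scalerA mulVf // scale1r => e.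
  have := rpredB e (memvZ (c2^-1 * c1) Tx).
  by rewrite scaleNr opprK mulrC scalerBr opprB [X in X + _]addrC [X in _ + X]addrC addrA addrK.
move: cT ce; rewrite c2_eq0 !scale0r !addr0 => cT.
have c1_eq0 : c1 = 0.
  apply/eqP; move: cT; rewrite rpredZeq => /orP[//|Tx0].
  case/negP: x_notin_H0; rewrite -[x]mul1r -a_ai -mulrA.
  by apply: coradical_mull => //; rewrite -(rpredBl _ Tx0) // opprB.
move=> c0E; have c0_eq0 : c0 = 0 by rewrite -[c0]mulr1; exact: c0E.
case/eqP: ci; have : i \in [:: ord0; lift ord0 ord0; lift ord0 (lift ord0 ord0)].
  by case: (i) => [[|[|[|]]]].
by rewrite !inE => /or3P[] /eqP ->.
Qed.

(** The component of y in degree g is g times its translate to degree 1, which is a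
    multiple of a^-1 x modulo H_0. *)
Lemma coradical1_rank1 : (coradical1 H <= below_degree 2 x)%VS.
Proof.
apply/subvP=> y y1; have [phi [lphi phiE]] := glval_dual H.
have sub_H0 : (H0 <= below_degree 2 x)%VS by rewrite -(below_degree1 x) below_degree_mono.
rewrite -[y](subrK (\sum_g hcomp phi g y)) rpredD //.
  exact: subvP sub_H0 _ (hcomp_sum pointed_H lphi phiE y1).
apply: rpred_sum => g _; set z := hcomp phi g y.
have z1 : z \in coradical1 H by apply: hcomp_coradical1.
have [c cz] := htrans_rank1 lphi phiE z1.
have := htrans_hcomp pointed_H lphi phiE g y1; rewrite -/z => gz.
have := rpredB cz gz; rewrite opprB addrC addrA subrK => e.
have := coradical_mull pointed_H g e.
rewrite mulrBr mulrA -glvalM mulgV mul1r -scalerAr mulrA -glvalM -[_ * x]/(pbw x (g * a^-1)%g 1).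
move/(subvP sub_H0) => e'.
by rewrite -[z](subrK (c *: pbw x (g * a^-1)%g 1)) rpredD ?memvZ ?pbw_below.
Qed.

End RankOne.

(** * Skew primitives in rank one *)

Section Conjugation.
Variables (k : fieldType) (H : hopfType k).
Implicit Types (g h b : grouplike H) (y : H).

Lemma skew_primitive_lin b (l : k) y z :
  y \in skew_primitive (glval b) 1 -> z \in skew_primitive (glval b) 1 ->
  l *: y + z \in skew_primitive (glval b) 1.
Proof.
move=> /eqP Dy /eqP Dz; apply/eqP; rewrite comul_is_linear Dy Dz.
by rewrite (tpure_linearl (glval b)) (tpure_linearr (1 : H)) scalerDr addrACA.
Qed.

Lemma conj_byE g y : conj_by g y = glval g * y * glval g^-1%g.
Proof. by rewrite glvalV. Qed.

Lemma conj_skew g b y : y \in skew_primitive (glval b) 1 ->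
  conj_by g y \in skew_primitive (glval (g * b * g^-1)%g) 1.
Proof.
move/eqP=> Dy; apply/eqP; rewrite conj_byE !comulM (glvalP g).1 (glvalP g^-1%g).1 Dy.
rewrite (linD (tmul_linearr _)) (linD (tmul_linearl _)) !tmul_pure mulr1 glval_mulV.
by rewrite !glvalM.
Qed.

Lemma conj_by_inj g : injective (conj_by g : H -> H).
Proof.
move=> y z; rewrite !conj_byE => /(congr1 (fun w => glval g^-1%g * w * glval g)).
by rewrite !mulrA glval_mulVl !mul1r -!mulrA glval_mulVl !mulr1.
Qed.

Lemma conj_by_coradical (pointed_H : pointed H) g y :
  (conj_by g y \in coradical H) = (y \in coradical H).
Proof.
have sub h z : z \in coradical H -> conj_by h z \in coradical H.
  case/(mem_coradicalP pointed_H) => c ->; rewrite conj_byE mulr_sumr mulr_suml.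
  by apply: rpred_sum => l _; rewrite -scalerAr -scalerAl memvZ // -!glvalM glval_coradical.
apply/idP/idP=> [/(sub g^-1%g)|]; last exact: sub.
by rewrite !conj_byE invgK !mulrA glval_mulVl mul1r -mulrA glval_mulVl mulr1.
Qed.

Lemma conj_by_linear g : linear (conj_by g : H -> H).
Proof. by move=> l y z; rewrite !conj_byE mulrDr mulrDl scalerAl scalerAr. Qed.
Lemma conj_byM g : {morph (conj_by g : H -> H) : y z / y * z}.
Proof. by move=> y z; rewrite !conj_byE !mulrA -[_ * glval g]mulrA glval_mulVl mulr1. Qed.
Lemma conj_by1 g : conj_by g (1 : H) = 1.
Proof. by rewrite conj_byE mulr1 glval_mulV. Qed.
Lemma conj_byX g y n : conj_by g (y ^+ n) = conj_by g y ^+ n.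
Proof. by elim: n => [|n IHn]; rewrite ?expr0 ?conj_by1 // !exprS conj_byM IHn. Qed.
Lemma conj_by_mul g h y : conj_by (g * h)%g y = conj_by g (conj_by h y).
Proof. by rewrite !conj_byE invMg !glvalM !mulrA. Qed.
Lemma conj_by_glval g h : conj_by g (glval h) = glval (g * h * g^-1)%g.
Proof. by rewrite conj_byE !glvalM. Qed.

End Conjugation.

Section SkewPrimitivesRankOne.
Variables (k : fieldType) (p : nat) (H : hopfType k) (a : grouplike H) (x : H).
Variables (q : k) (N : nat).
Hypotheses (char_k : p \in [pchar k]) (pointed_H : pointed H).
Hypotheses (Px : x \in skew_primitive (glval a) 1) (x_notin_H0 : x \notin coradical H).
Hypotheses (prim_q : N.-primitive_root q) (eigen_x : conj_by a x = q *: x).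
Hypothesis rank1 : has_rank H 1.
Implicit Types (g h b : grouplike H) (y : H).

Let q_neq0 : q != 0 := primitive_root_neq0 prim_q.

Lemma skew_primitive_rank1 b y : y \in skew_primitive (glval b) 1 ->
  exists c d : k, y = c *: (glval b - 1) + d *: x /\ (d != 0 -> b = a).
Proof.
move=> Py; have y2 := subvP (coradical1_rank1 pointed_H Px x_notin_H0 rank1) _ (skew_coradical1 Py).
have deg_x i : (i < 2)%N -> x ^+ i \notin below_degree i x.
  case: i => [|[|//]] _; last by rewrite below_degree1 expr1.
  by rewrite /below_degree big_ord0 expr0 memv0 oner_eq0.
have [c [d [yE dP]]] := skew_primitive_below pointed_H Px q_neq0 eigen_x (ltn0Sn 1) deg_x y2 Py.
exists c, (d 1%N); split=> [|d1].
  by rewrite yE big_mkcond !big_ord_recl big_ord0 /= expr1 addr0 add0r.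
by have [<- _] := dP 1%N isT d1; rewrite expg1.
Qed.

(** The conjugate of x is skew primitive for g a g^-1 and not in H_0, so its coefficient
    at x is nonzero, which forces g a g^-1 = a. *)
Lemma conj_skew_rank1 g : (g * a * g^-1 = a)%g /\
  exists c d : k, conj_by g x = c *: (glval a - 1) + d *: x /\ d != 0.
Proof.
have [c [d [xE da]]] := skew_primitive_rank1 (conj_skew g Px).
have d_neq0 : d != 0.
  apply: contra x_notin_H0 => /eqP d0; rewrite -(conj_by_coradical pointed_H g) xE d0 scale0r addr0.
  by rewrite memvZ // rpredB ?glval_coradical // -(glval1 H) glval_coradical.
have ga := da d_neq0; split=> //; exists c, d; split=> //.
by rewrite xE ga.
Qed.

(** The power x^N, and x^p when N = 1, is skew primitive, hence in H_1 and so in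
    H_0 + H_0 x: it cannot be a power strictly between x and x^n. *)
Lemma rank1_degree r : has_degree x (N * p ^ r) -> (r = 0%N /\ (1 < N)%N) \/ (r = 1%N /\ N = 1%N).
Proof.
move=> deg_x; have n_gt1 := degree_gt1 x_notin_H0 deg_x.
have p_pr := pcharf_prime char_k; have N_gt0 := prim_order_gt0 prim_q.
have primV := primitive_rootV prim_q.
(* A skew primitive x^m lies in H_1, hence in H_0 + H_0 x, and is a combination of
   smaller powers: m is not below the degree. *)
have no_skew m : (1 < m < N * p ^ r)%N -> (forall j, (0 < j < m)%N -> gbin q^-1 m j = 0) -> False.
  case/andP=> m_gt1 lt_m row0; have m_gt0 := ltnW m_gt1.
  have /skew_coradical1 := skew_primitive_expr Px q_neq0 eigen_x m_gt0 row0.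
  move/(subvP (coradical1_rank1 pointed_H Px x_notin_H0 rank1)).
  move/(subvP (below_degree_mono x pointed_H m_gt1)).
  by have [_ /(_ m lt_m)/negP] := deg_x.
have [N_gt1|N_le1] := ltnP 1 N.
  case: r => [|r] in deg_x n_gt1 no_skew *; [by left | exfalso].
  apply: (no_skew N) => [|j]; last exact: gbin_prim_mid primV _.
  by rewrite N_gt1 ltn_Pmulr // (leq_ltn_trans (ltn0Sn r) (ltn_expl r.+1 (prime_gt1 p_pr))).
have N1 : N = 1%N by apply/eqP; rewrite eqn_leq N_le1 N_gt0.
right; split=> //; rewrite N1 mul1n in deg_x n_gt1 no_skew.
case: r => [|[|r]] in deg_x n_gt1 no_skew *; [by rewrite expn0 in n_gt1 | by [] | exfalso].
apply: (no_skew p) => [|j /andP[j_gt0 lt_jp]].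
  by rewrite prime_gt1 //=; have := ltn_exp2l 1 r.+2 (prime_gt1 p_pr); rewrite expn1.
have := gbin_mulN primV p j; rewrite N1 !mul1n => ->; apply/eqP.
by rewrite -(dvdn_pcharf char_k) prime_dvd_bin ?j_gt0.
Qed.

(** Conjugation by g sends x to c (a - 1) + chi x. As g commutes with a, conjugating
    once more by a shows (q - 1) c (a - 1) = 0. *)
Lemma conj_character : (1 < N)%N ->
  exists chi : grouplike H -> k,
    [/\ forall g, chi g <> 0,
        forall g h, chi (g * h)%g = chi g * chi h &
        forall g, conj_by g x = chi g *: x].
Proof.
move=> N_gt1; have x_neq0 := skew_neq0 x_notin_H0.
have conj_x g : exists d, conj_by g x == d *: x.
  have [ga [c [d [xE d0]]]] := conj_skew_rank1 g; exists d.
  have e : conj_by a (conj_by g x) = conj_by g (conj_by a x).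
    rewrite -!conj_by_mul; congr (conj_by _ x).
    by rewrite -{1}ga mulgKV.
  move: e; rewrite eigen_x (linZ _ _ (conj_by_linear g)) {1}xE.
  rewrite (linD (conj_by_linear _)) !(linZ _ _ (conj_by_linear _)).
  rewrite (linB (conj_by_linear _)) conj_by1 conj_by_glval mulgK eigen_x xE.
  rewrite [q *: (_ + d *: x)]scalerDr !scalerA [d * q]mulrC => /addIr/eqP.
  rewrite -subr_eq0 -scalerBl -{1}[c]mul1r -mulrBl -scalerA scaler_eq0 subr_eq0.
  case/orP=> [/eqP q1|/eqP ->].
    have := prim_order_dvd prim_q 1; rewrite -q1 expr1n eqxx dvdn1 => /eqP N1.
    by rewrite N1 in N_gt1.
  by rewrite add0r.
pose chi g := xchoose (conj_x g).
have chiE g : conj_by g x = chi g *: x := eqP (xchooseP (conj_x g)).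
exists chi; split=> // [g chi0|g h].
  have := chiE g; rewrite chi0 scale0r -(lin0 (conj_by_linear g)) => /conj_by_inj/eqP.
  by rewrite (negPf x_neq0).
apply/eqP; rewrite -subr_eq0; have : (chi (g * h)%g - chi g * chi h) *: x = 0.
  rewrite scalerBl -chiE conj_by_mul !chiE (linZ _ _ (conj_by_linear g)) chiE scalerA mulrC.
  by rewrite subrr.
by move/eqP; rewrite scaler_eq0 (negPf x_neq0) orbF.
Qed.

(** All elements of P_(a,1) commute with a when x does, and y = x - beta (a - 1) has
    y^p = x^p - beta^p (a^p - 1). If g y g^-1 = e (a - 1) + d y and y^p = 0, taking p-th powers
    gives e^p (a^p - 1) = 0. *)
Lemma rank1_eigenvalue1 : N = 1%N ->
  (forall y : H, y \in skew_primitive (glval a) 1 -> y \notin coradical H ->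
     conj_by a y = 1 *: y) /\
  (forall alpha_m1 alpha_0 : k,
     x ^+ p = alpha_m1 *: (glval a ^+ p - 1) + alpha_0 *: x ->
     alpha_0 = 0 -> GRing.closed_field_axiom k ->
     exists y : H,
       [/\ y \in skew_primitive (glval a) 1, y \notin coradical H,
           y ^+ p = 0 &
           #[a]%g <> p -> common_conj_eigenvector y]).
Proof.
move=> N1; have p_pr := pcharf_prime char_k.
have q1 : q = 1 by have := prim_expr_order prim_q; rewrite N1 expr1.
have charH : p \in [pchar H].
  by rewrite inE p_pr /= -scaler_nat (pcharf0 char_k) scale0r.
have comm_ax : GRing.comm (glval a) x by rewrite /GRing.comm (commute_eigen eigen_x) q1 scale1r.
have comm_ra (u v : H) : GRing.comm u v -> forall l m : k, GRing.comm (l *: u) (m *: v : H).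
  by move=> uv l m; rewrite /GRing.comm -!scalerAl -!scalerAr uv !scalerA mulrC.
have comm_xa1 : GRing.comm x (glval a - 1).
  by apply: commrB; [apply/commr_sym | apply: commr1].
have powp u v : GRing.comm u v -> (u + v : H) ^+ p = u ^+ p + v ^+ p.
  by move=> uv; rewrite -!(pFrobenius_autE charH) pFrobenius_autD_comm.
have a1p : (glval a - 1) ^+ p = glval a ^+ p - 1 :> H.
  by rewrite -!(pFrobenius_autE charH) pFrobenius_autB_comm ?pFrobenius_aut1 //; apply: commr1.
split=> [y Py _|am1 a0 xp a0_eq0 closed_k].
  have [c [d [-> _]]] := skew_primitive_rank1 Py.
  rewrite scale1r (linD (conj_by_linear _)) !(linZ _ _ (conj_by_linear _)) eigen_x q1 scale1r.
  by rewrite (linB (conj_by_linear _)) conj_by1 conj_by_glval mulgK.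
have [beta betaE] := closed_k p (fun i => if i == 0%N then am1 else 0) (prime_gt0 p_pr).
have beta_p : beta ^+ p = am1.
  rewrite betaE; case: (p) (prime_gt0 p_pr) => // p' _.
  by rewrite big_ord_recl /= expr0 mulr1 big1 ?addr0 // => i _; rewrite mul0r.
pose y := x + (- beta) *: (glval a - 1).
have yp : y ^+ p = 0.
  rewrite powp; last by rewrite -[x]scale1r; apply: comm_ra.
  rewrite exprZn a1p xp a0_eq0 scale0r addr0 -!(pFrobenius_autE char_k) pFrobenius_autN.
  by rewrite pFrobenius_autE beta_p scaleNr subrr.
have a1_H0 : glval a - 1 \in coradical H.
  by rewrite rpredB ?glval_coradical // -(glval1 H) glval_coradical.
have y_H0 : y \notin coradical H by rewrite rpredDr ?memvZ.
have Pa1 : glval a - 1 \in skew_primitive (glval a) 1.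
  apply/eqP; rewrite (linB (@comul_is_linear k H)) comul1 (glvalP a).1.
  rewrite (linB (@tpure_linearl k H H _)) (linB (@tpure_linearr k H H _)).
  by rewrite addrA subrK.
have Py : y \in skew_primitive (glval a) 1 by rewrite /y addrC skew_primitive_lin.
exists y; split=> // a_p; split=> [|g]; first by apply: contra y_H0 => /eqP->; apply: mem0v.
have [ga [c [d [xE _]]]] := conj_skew_rank1 g; exists d.
have gy : conj_by g y = (c - beta + d * beta) *: (glval a - 1) + d *: y.
  rewrite (linD (conj_by_linear _)) (linZ _ _ (conj_by_linear _)) (linB (conj_by_linear _)).
  rewrite conj_by1 conj_by_glval ga xE /y; move: (glval a - 1) => u.
  by rewrite scalerDr scalerA mulrN !scalerDl !scaleNr [d *: x - _]addrC addrA addrK addrAC.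
set e := c - beta + _ in gy; suff ea : e *: (glval a - 1) = 0 by rewrite gy ea add0r.
have := congr1 (fun z => z ^+ p) gy.
rewrite -conj_byX yp (lin0 (conj_by_linear g)) powp; last first.
  apply: (comm_ra); rewrite /y; apply: commrD; first exact/commr_sym.
  by have := comm_ra _ _ (commr_refl (glval a - 1)) 1 (- beta); rewrite scale1r.
rewrite !exprZn yp scaler0 addr0 a1p => /esym/eqP; rewrite scaler_eq0 expf_eq0 prime_gt0 //=.
case/orP=> [/eqP ->|]; first by rewrite scale0r.
rewrite subr_eq0 -glvalX -(glval1 H) => /eqP/glval_inj ap.
have [a1|a1] := eqVneq a 1%g; first by rewrite a1 subrr scaler0.
case: a_p; apply: nt_prime_order => //.
Qed.

End SkewPrimitivesRankOne.

(** * The conjugation action on a sub Hopf algebra *)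

Section ConjugationAction.
Variables (k : fieldType) (H : hopfType k).
Implicit Types (g h : grouplike H) (y : H).

Lemma tmap_tensorv (U V U' V' : vectType k) (A : {vspace U}) (B : {vspace V})
    (A' : {vspace U'}) (B' : {vspace V'}) (f : U -> U') (f' : V -> V') t :
  linear f -> linear f' -> (forall u, u \in A -> f u \in A') ->
  (forall v, v \in B -> f' v \in B') -> t \in tensorv A B -> tmap f f' t \in tensorv A' B'.
Proof.
move=> lf lf' fA fB; have [W WE] := linear_preim (tensorv A' B') (tmap_is_linear f f').
rewrite -WE; apply/subvP: t; apply: vspan_sub => _ [u [v [uA vB ->]]].
by rewrite WE tmapE // mem_tensorv ?fA ?fB.
Qed.

Lemma tmap_comp (U V U' V' U'' V'' : vectType k) (f : U -> U') (f' : V -> V')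
    (h : U' -> U'') (h' : V' -> V'') t :
  linear f -> linear f' -> linear h -> linear h' ->
  tmap h h' (tmap f f' t) = tmap (fun u => h (f u)) (fun v => h' (f' v)) t.
Proof.
move=> lf lf' lh lh'; move: t; apply: tensor_extP => [||u v].
- by apply: comp_is_linear; apply: tmap_is_linear.
- exact: tmap_is_linear.
- rewrite !tmapE //; exact: comp_is_linear.
Qed.

Lemma eq_tmap (U V U' V' : vectType k) (f h : U -> U') (f' h' : V -> V') (t : tensor U V) :
  f =1 h -> f' =1 h' -> tmap f f' t = tmap h h' t.
Proof. by move=> fh fh'; apply: eq_tlift => u v; rewrite fh fh'. Qed.

Lemma comul_conj_by g y : comul (conj_by g y) = tmap (conj_by g) (conj_by g) (comul y).
Proof.
rewrite conj_byE !comulM (glvalP g).1 (glvalP g^-1%g).1.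
move: (comul y); apply: tensor_extP => [||u v].
- exact: comp_is_linear (tmul_linearl _) (tmul_linearr _).
- exact: tmap_is_linear.
- by rewrite !tmul_pure tmapE ?conj_byE //; exact: conj_by_linear.
Qed.

Lemma counit_conj_by g y : counit (conj_by g y) = counit y.
Proof. by rewrite conj_byE !counitM (glvalP g).2 (glvalP g^-1%g).2 mul1r mulr1. Qed.

Lemma antipode_conj_by g y : antipode (conj_by g y) = conj_by g (antipode y).
Proof. by rewrite !conj_byE -mulrA antipode_mulg antipode_mulrg invgK. Qed.

Lemma conj_by1g y : conj_by 1%g y = y.
Proof. by rewrite conj_byE invg1 glval1 mul1r mulr1. Qed.

Lemma conj_byK g : cancel (conj_by g) (conj_by g^-1%g : H -> H).
Proof. by move=> y; rewrite -conj_by_mul mulVg conj_by1g. Qed.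

Lemma conj_byVK g : cancel (conj_by g^-1%g) (conj_by g : H -> H).
Proof. by move=> y; rewrite -conj_by_mul mulgV conj_by1g. Qed.

(** The preimage of a sub Hopf algebra under conjugation is one too, so it is enough to
    look at generators. *)
Lemma conj_by_subhopf_gen (s : seq H) g :
  (forall y, y \in s -> conj_by g y \in subhopf_vspace (subhopf_gen s)) ->
  forall y, y \in subhopf_vspace (subhopf_gen s) -> conj_by g y \in subhopf_vspace (subhopf_gen s).
Proof.
set A := subhopf_gen s => sA; have lc := @conj_by_linear k H.
have [U UE] := linear_preim (subhopf_vspace A) (lc g).
have [A1 AM AD AS] := subhopfP A.
have hopfU : is_subhopf U.
  split=> [|y z|y|y].
  - by rewrite UE conj_by1.
  - by rewrite !UE conj_byM; apply: AM.
  - rewrite UE => /AD; rewrite comul_conj_by => t_A.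
    have -> : comul y =
        tmap (conj_by g^-1%g) (conj_by g^-1%g) (tmap (conj_by g) (conj_by g) (comul y)).
      by rewrite tmap_comp // -{1}[comul y]tlift_pure; apply: eq_tlift => u v; rewrite !conj_byK.
    by apply: tmap_tensorv t_A => // u uA; rewrite UE conj_byVK.
  - by rewrite !UE => /AS; rewrite antipode_conj_by.
move=> y yA; rewrite -UE; apply: (subvP (subhopf_gen_min (B := SubHopf hopfU) _)) yA.
by move=> z zs /=; rewrite UE sA.
Qed.

Section Action.
Variable A : subHopf H.
Hypothesis conjA : forall g y, y \in subhopf_vspace A -> conj_by g y \in subhopf_vspace A.

Local Notation ev := (@subhopf_val k H A).

Definition conj_hact g (u : subhopf_of A) : subhopf_of A := subhopf_proj A (conj_by g (ev u)).

Lemma conj_hactE g u : ev (conj_hact g u) = conj_by g (ev u).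
Proof. by rewrite subhopf_projK // conjA // subhopf_valP. Qed.

Lemma conj_hact_linear g : linear (conj_hact g).
Proof.
apply: comp_is_linear; first exact: subhopf_proj_linear.
by apply: comp_is_linear; [exact: conj_by_linear | exact: subhopf_val_linear].
Qed.

Lemma conj_hact1g u : conj_hact 1%g u = u.
Proof. by apply: subhopf_val_inj; rewrite conj_hactE conj_by1g. Qed.

Lemma conj_hactMg g h u : conj_hact (g * h)%g u = conj_hact g (conj_hact h u).
Proof. by apply: subhopf_val_inj; rewrite !conj_hactE conj_by_mul. Qed.

Lemma conj_hact1 g : conj_hact g 1 = 1.
Proof. by apply: subhopf_val_inj; rewrite conj_hactE subhopf_val1 conj_by1. Qed.

Lemma conj_hactM g : {morph conj_hact g : u v / u * v}.
Proof.
move=> u v; apply: subhopf_val_inj.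
by rewrite subhopf_valM !conj_hactE subhopf_valM conj_byM.
Qed.

Lemma conj_hact_comul g u : comul (conj_hact g u) = tmap (conj_hact g) (conj_hact g) (comul u).
Proof.
have lev := @subhopf_val_linear k H A; have lg := conj_hact_linear g.
have lc := @conj_by_linear k H g.
apply: tmap_ev_inj; rewrite [LHS]subhopf_comulE conj_hactE comul_conj_by -subhopf_comulE.
rewrite -[subhopf_comul u]/(comul u); move: (comul u) => t.
by rewrite !tmap_comp //; apply: eq_tmap => v; rewrite conj_hactE.
Qed.

Lemma conj_hact_counit g u : counit (conj_hact g u) = counit u.
Proof. by rewrite [LHS]/(subhopf_counit _) /subhopf_counit conj_hactE counit_conj_by. Qed.

Definition conj_action : hopf_action (grouplike H) (subhopf_of A) :=
  HopfAction conj_hact_linear conj_hact1g conj_hactMg conj_hact1 conj_hactM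
    conj_hact_comul conj_hact_counit.

End Action.
End ConjugationAction.

(** * The sub Hopf algebra generated by a and x *)

Section GeneratedSubHopf.
Variables (k : fieldType) (p : nat) (H : hopfType k) (a : grouplike H) (x : H).
Variables (q : k) (N : nat).
Hypotheses (char_k : p \in [pchar k]) (pointed_H : pointed H).
Hypotheses (Px : x \in skew_primitive (glval a) 1) (x_notin_H0 : x \notin coradical H).
Hypotheses (prim_q : N.-primitive_root q) (eigen_x : conj_by a x = q *: x).
Variable n : nat.
Hypothesis deg_x : has_degree x n.

Let q_neq0 : q != 0 := primitive_root_neq0 prim_q.
Let n_gt1 : (1 < n)%N := degree_gt1 x_notin_H0 deg_x.

(** A candidate for the sub Hopf algebra generated by a and x. *)
Definition cyclic_pbw : {vspace H} :=
  vspan (fun y => exists j i, (i < n)%N /\ y = pbw x (a ^+ j)%g i).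

Local Notation W := cyclic_pbw.

Lemma pbw_cyclic j i : (i < n)%N -> pbw x (a ^+ j)%g i \in W.
Proof. by move=> lt_in; apply: mem_vspan; exists j, i. Qed.

Lemma cyclic_pbw_sub (U : {vspace H}) :
  (forall j i, (i < n)%N -> pbw x (a ^+ j)%g i \in U) -> forall y, y \in W -> y \in U.
Proof. by move=> sU; apply/subvP/vspan_sub => _ [j [i [lt_in ->]]]; apply: sU. Qed.

Lemma glval_cyclic_mul j y : y \in W -> glval (a ^+ j)%g * y \in W.
Proof.
have [U UE] := linear_preim W (mull_is_linear (glval (a ^+ j)%g)).
rewrite -UE; apply: cyclic_pbw_sub => j' i lt_in.
by rewrite UE mul_glval_pbw -expgnDr pbw_cyclic.
Qed.

(** The only product leaving the spanning set is x^n, which by its expression through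
    lower powers of x and a^n - 1 lies in the span. *)
Lemma x_cyclic_mul y : y \in W -> x * y \in W.
Proof.
have [U UE] := linear_preim W (mull_is_linear x).
have xn : x ^+ n \in W.
  have [r [ne [c [al [-> _]]]]] := expr_degree char_k pointed_H Px x_notin_H0 prim_q eigen_x deg_x.
  have n_gt0 := ltnW n_gt1; rewrite rpredD ?memvZ //.
    rewrite rpredB // -?glvalX -?(glval1 H) -[glval _]mulr1 -(expr0 x).
      exact: pbw_cyclic.
    exact: (pbw_cyclic 0%N).
  apply: rpred_sum => s _; rewrite memvZ // -[x ^+ _]mul1r; apply: (pbw_cyclic 0%N).
  rewrite ne ltn_pmul2l ?(prim_order_gt0 prim_q) // ltn_exp2l ?ltn_ord //.
  exact/prime_gt1/(pcharf_prime char_k).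
rewrite -UE; apply: cyclic_pbw_sub => j i lt_in; rewrite UE /pbw glvalX.
have -> : x * (glval a ^+ j * x ^+ i) = q ^- j *: (glval (a ^+ j)%g * x ^+ i.+1).
  rewrite mulrA exprS mulrA glvalX (glval_expr_mul eigen_x) -scalerAl scalerA mulVf ?expf_neq0 //.
  by rewrite scale1r.
rewrite memvZ //; have [lt_i1n|] := ltnP i.+1 n; first exact: pbw_cyclic.
move=> ge_i1n; have -> : i.+1 = n by apply/eqP; rewrite eqn_leq ge_i1n lt_in.
exact: glval_cyclic_mul.
Qed.

Lemma cyclic_pbwM : {in W &, forall y z, y * z \in W}.
Proof.
move=> y z yW zW; move: y yW.
have [U UE] := linear_preim W (mulr_is_linear z).
move=> y yW; rewrite -UE; apply: cyclic_pbw_sub yW => j i _; rewrite UE /pbw -mulrA.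
apply: glval_cyclic_mul; elim: i => [|i IHi]; first by rewrite mul1r.
by rewrite exprS -mulrA x_cyclic_mul.
Qed.

Lemma cyclic_pbw_subhopf : is_subhopf W.
Proof.
have n_gt0 := ltnW n_gt1.
have aW j : glval (a ^+ j)%g \in W by have := pbw_cyclic j n_gt0; rewrite /pbw expr0 mulr1.
(* a has finite order, so that its inverse is a power of a. *)
have aVW : glval a^-1%g \in W by rewrite invg_expg.
have xW : x \in W by have := pbw_cyclic 0 n_gt1; rewrite /pbw expr1 mul1r.
split=> [||y|y]; [exact: (aW 0%N) | exact: cyclic_pbwM | |].
  have [U UE] := linear_preim (tensorv W W) (@comul_is_linear k H).
  rewrite -UE; apply: cyclic_pbw_sub => j i lt_in; rewrite UE.
  rewrite (comul_pbw Px q_neq0 eigen_x); apply: rpred_sum => l _; rewrite memvZ // -expgnDr.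
  rewrite mem_tensorv ?pbw_cyclic ?(leq_ltn_trans (leq_subr _ _)) //.
  by rewrite (leq_trans (ltn_ord l)).
have [U UE] := linear_preim W (@antipode_is_linear k H).
rewrite -UE; apply: cyclic_pbw_sub => j i _; rewrite UE; elim: i => [|i IHi].
  rewrite /pbw expr0 mulr1 -[antipode _]/(glval (a ^+ j)^-1%g).
  by rewrite invg_expg -expgnA.
rewrite -pbw_mulx (antipode_mul_skew _ Px (counit_skew Px)).
by rewrite cyclic_pbwM // rpredN cyclic_pbwM.
Qed.

Lemma subhopf_gen_cyclic y :
  y \in subhopf_vspace (subhopf_gen [:: glval a; x]) -> y \in W.
Proof.
apply/subvP; apply: (subhopf_gen_min (B := SubHopf cyclic_pbw_subhopf)) => z.
rewrite !inE => /orP[] /eqP -> /=.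
  by have := pbw_cyclic 1 (ltnW n_gt1); rewrite /pbw expr0 mulr1 expg1.
by have := pbw_cyclic 0 n_gt1; rewrite /pbw expr1 mul1r.
Qed.

End GeneratedSubHopf.

Section TwoSidedIdeal.
Variables (k : fieldType) (A : falgType k) (t : A).

Lemma ideal_gen_id : t \in ideal_gen t.
Proof.
have := memv_mul (memv_mul (memvf (1 : A)) (memv_line t)) (memvf (1 : A)).
by rewrite mul1r mulr1.
Qed.

Lemma ideal_genMl u v : v \in ideal_gen t -> u * v \in ideal_gen t.
Proof.
move=> vI; have := memv_mul (memvf u) vI; rewrite /ideal_gen !prodvA.
by apply/subvP; do 2 apply: prodvSl; apply: subvf.
Qed.

Lemma ideal_genMr u v : v \in ideal_gen t -> v * u \in ideal_gen t.
Proof.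
move=> vI; have := memv_mul vI (memvf u); rewrite /ideal_gen -!prodvA.
by apply/subvP; do 2 apply: prodvSr; apply: subvf.
Qed.

Lemma ideal_gen_expB (u v : A) n : t = u - v -> u ^+ n - v ^+ n \in ideal_gen t.
Proof.
move=> te; elim: n => [|n IHn]; first by rewrite !expr0 subrr mem0v.
have -> : u ^+ n.+1 - v ^+ n.+1 = u * (u ^+ n - v ^+ n) + t * v ^+ n.
  by rewrite te mulrBr mulrBl -!exprS addrA subrK.
by rewrite rpredD //; [apply: ideal_genMl | exact/ideal_genMr/ideal_gen_id].
Qed.

End TwoSidedIdeal.

Section SmashMap.
Variables (k : fieldType) (H : hopfType k) (A : subHopf H).
Hypothesis conjA : forall (g : grouplike H) y,
  y \in subhopf_vspace A -> conj_by g y \in subhopf_vspace A.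

Local Notation ev := (@subhopf_val k H A).
Local Notation rho := (conj_action conjA).

Let lev : linear ev := @subhopf_val_linear k H A.

Definition smash_map_fun (f : smash rho) : H := \sum_g ev (f g) * glval g.

Lemma smash_map_fun_linear : linear smash_map_fun.
Proof.
apply: sum_is_linear => g l f1 f2; rewrite !ffunE.
by rewrite (comp_is_linear (mulr_is_linear (glval g)) lev).
Qed.

HB.instance Definition _ :=
  GRing.isLinear.Build k (smash rho) H _ smash_map_fun smash_map_fun_linear.

Definition smash_map : 'Hom(smash rho, H) := linfun smash_map_fun.

Lemma smash_map_pure u g : smash_map (smash_pure rho u g) = ev u * glval g.
Proof.
rewrite lfunE /= /smash_map_fun (bigD1 g) //= ffunE eqxx big1 ?addr0 // => h gh.
by rewrite ffunE (negPf gh) (lin0 lev) mul0r.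
Qed.

Lemma smash_map_linear : linear smash_map. Proof. exact: linearP. Qed.

Lemma smash_map1 : smash_map 1 = 1.
Proof. by rewrite [1 in LHS]/(smash_pure rho 1 1%g) smash_map_pure subhopf_val1 mulr1. Qed.

Lemma smash_mapM : {morph smash_map : f1 f2 / f1 * f2}.
Proof.
have lm := smash_map_linear.
move=> f1 f2; move: f1; apply: smash_ext => [||u g].
- exact: comp_is_linear lm (smash_mul_linearl _).
- exact: comp_is_linear (mulr_is_linear _) lm.
move: f2; apply: smash_ext => [||v h].
- exact: comp_is_linear lm (smash_mul_linearr _).
- exact: comp_is_linear (mull_is_linear _) lm.
rewrite smash_mulE !smash_map_pure subhopf_valM (conj_hactE conjA) conj_byE glvalM.
by rewrite !mulrA -[_ * glval g]mulrA glval_mulVl mulr1.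
Qed.

Lemma smash_map_hopf : is_hopf_hom smash_map.
Proof.
have lm := smash_map_linear; have lsm g := smash_pure_linear rho g.
split=> [||f|f|f]; [exact: smash_map1 | exact: smash_mapM | | |]; move: f.
- apply: smash_ext => [||u g].
  + exact: comp_is_linear (@comul_is_linear k H) lm.
  + exact: comp_is_linear (tmap_is_linear _ _) (@comul_is_linear k (smash rho)).
  rewrite smash_map_pure comulM (glvalP g).1 -subhopf_comulE.
  have -> : comul (smash_pure rho u g) = _ := smash_comul_pure rho u g.
  rewrite -[subhopf_comul u]/(comul u) -[RHS]/(tmap smash_map smash_map _) tmap_comp //.
  move: (comul u); apply: tensor_extP => [||v w].
  + exact: comp_is_linear (tmul_linearl _) (tmap_is_linear _ _).
  + exact: tmap_is_linear.
  rewrite !tmapE ?tmul_pure ?smash_map_pure //; exact: comp_is_linear lm (lsm g).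
- apply: (@smash_ext _ _ _ _ k^o) => [||u g].
  + exact: comp_is_linear (@counit_is_scalar k H : linear (counit : H -> k^o)) lm.
  + exact: (@counit_is_scalar k (smash rho)).
  by rewrite smash_map_pure counitM (glvalP g).2 mulr1 [RHS](smash_counit_pure rho).
- apply: smash_ext => [||u g].
  + exact: comp_is_linear lm (@antipode_is_linear k (smash rho)).
  + exact: comp_is_linear (@antipode_is_linear k H) lm.
  have -> : antipode (smash_pure rho u g) = _ := smash_antipode_pure rho u g.
  rewrite !smash_map_pure antipode_mulrg.
  rewrite (conj_hactE conjA) subhopf_antipodeE conj_byE invgK -mulrA glval_mulV mulr1.
  by [].
Qed.

End SmashMap.

(** * The presentation as a quotient of the smash product *)

Section SmashPresentation.
Variables (k : fieldType) (p : nat) (H : hopfType k) (a : grouplike H) (x : H).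
Variables (q : k) (N : nat).
Hypotheses (char_k : p \in [pchar k]) (pointed_H : pointed H).
Hypotheses (Px : x \in skew_primitive (glval a) 1) (x_notin_H0 : x \notin coradical H).
Hypotheses (prim_q : N.-primitive_root q) (eigen_x : conj_by a x = q *: x).
Variable A : subHopf H.
Hypothesis conjA : forall (g : grouplike H) y,
  y \in subhopf_vspace A -> conj_by g y \in subhopf_vspace A.
Hypotheses (aA : glval a \in subhopf_vspace A) (xA : x \in subhopf_vspace A).

Local Notation ev := (@subhopf_val k H A).
Local Notation pr := (@subhopf_proj k H A).
Local Notation rho := (conj_action conjA).
Local Notation pi := (smash_map conjA).
Local Notation t := (smash_pure rho (pr (glval a)) 1%g - smash_pure rho 1 a).
Local Notation I := (ideal_gen t).

Lemma exprA i : x ^+ i \in subhopf_vspace A.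
Proof.
have [A1 AM _ _] := subhopfP A.
by elim: i => [|i IHi]; rewrite ?expr0 // exprS AM.
Qed.

Lemma glval_exprA j : glval (a ^+ j)%g \in subhopf_vspace A.
Proof.
have [A1 AM _ _] := subhopfP A.
by elim: j => [|j IHj]; rewrite // expgS glvalM AM.
Qed.

(** The image is a subalgebra containing G and x, hence H_0 + H_0 x, hence the generating
    space H_1. *)
Lemma limg_smash_map : (coradical1 H <= below_degree 2 x)%VS ->
  agenv (coradical1 H) = fullv -> limg pi = fullv.
Proof.
move=> H1x genH1; apply/eqP; rewrite eqEsubv subvf -genH1.
have imM y z : y \in limg pi -> z \in limg pi -> y * z \in limg pi.
  move=> /memv_imgP[u _ ->] /memv_imgP[v _ ->].
  by rewrite -smash_mapM memv_img ?memvf.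
have im1 : 1 \in limg pi by rewrite -(smash_map1 conjA) memv_img ?memvf.
apply: agenv_sub_modl => //; apply/prodvP=> y z /(subvP H1x) y2 zI; apply: (imM) zI.
move: y y2; apply/subvP/below_degree_sub => // g i _; rewrite /pbw imM //.
  have := smash_map_pure conjA 1 g; rewrite subhopf_val1 mul1r => <-.
  by rewrite memv_img ?memvf.
have := smash_map_pure conjA (pr (x ^+ i)) 1%g.
by rewrite subhopf_projK ?exprA // glval1 mulr1 => <-; rewrite memv_img ?memvf.
Qed.

Lemma ideal_sub_lker : (I <= lker pi)%VS.
Proof.
have kerM y z : y \in lker pi -> y * z \in lker pi.
  by rewrite !memv_ker smash_mapM => /eqP ->; rewrite mul0r.
apply/prodvP=> y z yI _; apply: kerM; move: y yI; apply/subvP/prodvP=> y z' _ /vlineP[l ->].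
rewrite memv_ker smash_mapM linearZ linearB /= !smash_map_pure.
by rewrite subhopf_projK // subhopf_val1 mulr1 mul1r subrr scaler0 mulr0.
Qed.

Local Notation e g i := (smash_pure rho 1 g * smash_pure rho (pr (x ^+ i)) 1%g).

(** Modulo the ideal a power of a can be moved from A to the group algebra, so the smash
    product is spanned by the g x^i with i < n. *)
Lemma smash_span n : (forall y, y \in subhopf_vspace A -> y \in cyclic_pbw a x n) ->
  forall f : smash rho, f \in (I + \sum_(gi : grouplike H * 'I_n) <[e gi.1 gi.2]>)%VS.
Proof.
move=> sAW f; set V := (_ + _)%VS; rewrite (smash_sum f); apply: rpred_sum => g _.
have -> : smash_pure rho (f g) g = smash_pure rho 1 g * smash_pure rho (rho g^-1%g (f g)) 1%g.
  by rewrite smash_mulE mulg1 mul1r -hactMg mulgV hact1g.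
move: (rho _ _) => u; rewrite -(subhopf_valK u).
have lF : linear (fun y => smash_pure rho 1 g * smash_pure rho (pr y) 1%g : smash rho).
  apply: comp_is_linear (smash_mul_linearr _) _; apply: comp_is_linear (smash_pure_linear _ _) _.
  exact: subhopf_proj_linear.
have [U UE] := linear_preim V lF; rewrite -UE.
move: (sAW _ (subhopf_valP u)); apply: cyclic_pbw_sub => j i lt_in; rewrite UE.
have prM : pr (pbw x (a ^+ j)%g i) = pr (glval (a ^+ j)%g) * pr (x ^+ i).
  have [_ AM _ _] := subhopfP A.
  by apply: subhopf_val_inj; rewrite subhopf_valM !subhopf_projK ?AM ?exprA ?glval_exprA.
have -> : smash_pure rho (pr (pbw x (a ^+ j)%g i)) 1%g =
    smash_pure rho (pr (glval a)) 1%g ^+ j * smash_pure rho (pr (x ^+ i)) 1%g :> smash rho.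
  have -> : smash_pure rho (pr (glval a)) 1%g ^+ j =
      smash_pure rho (pr (glval (a ^+ j)%g)) 1%g :> smash rho.
    elim: j {lt_in prM} => [|j IHj].
      rewrite expr0; congr (smash_pure rho _ _); apply: subhopf_val_inj.
      by rewrite subhopf_val1 subhopf_projK ?(glval_exprA 0).
    rewrite exprS IHj smash_mulE hact1g mulg1; congr (smash_pure rho _ _).
    have [_ AM _ _] := subhopfP A.
    by apply: subhopf_val_inj; rewrite subhopf_valM !subhopf_projK ?glval_exprA // expgS.
  by rewrite smash_mulE hact1g mulg1 -prM.
rewrite -[_ ^+ j](subrK (smash_pure rho 1 a ^+ j : smash rho)) mulrDl mulrDr rpredD //.
  apply: (subvP (addvSl _ _)); apply/ideal_genMl/ideal_genMr; exact: ideal_gen_expB.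
apply: (subvP (addvSr _ _)); rewrite mulrA.
have -> : smash_pure rho 1 g * smash_pure rho 1 a ^+ j =
    smash_pure rho 1 (g * a ^+ j)%g :> smash rho.
  elim: j {lt_in prM} => [|j IHj]; first by rewrite expr0 mulr1 mulg1.
  by rewrite exprSr mulrA IHj smash_mulE hact1 mulr1 -mulgA -expgSr.
by rewrite memvE (sumv_sup ((g * a ^+ j)%g, Ordinal lt_in)).
Qed.

(** An element of the kernel is, modulo the ideal, a combination of the g x^i with i < n,
    whose images are linearly independent. *)
Lemma lker_smash_map n : has_degree x n ->
  (forall y, y \in subhopf_vspace A -> y \in cyclic_pbw a x n) -> lker pi = I.
Proof.
move=> [_ deg_x] sAW; apply/eqP; rewrite eqEsubv ideal_sub_lker andbT.
have q_neq0 := primitive_root_neq0 prim_q.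
apply/subvP=> f; have /memv_addP[z zI [w /mem_sum_linesP[c ->] ->]] := smash_span sAW f.
rewrite memv_ker linearD /=; have /eqP -> : pi z == 0 by rewrite -memv_ker (subvP ideal_sub_lker).
rewrite add0r linear_sum /= => /eqP c0.
pose c' (g : grouplike H) (i : nat) := oapp (fun i' : 'I_n => c (g, i')) 0 (insub i).
have c'0 := @pbw_indep _ _ _ _ _ pointed_H Px q_neq0 eigen_x n c' deg_x _.
rewrite big1 ?addr0 // => -[g i] _ /=; suff -> : c (g, i) = 0 by rewrite scale0r.
have := c'0 _ g i (ltn_ord i); rewrite /c' valK; apply.
rewrite -[RHS]c0 pair_bigA /=; apply: eq_bigr => -[h j] _ /=; rewrite valK /= linearZ /=.
congr (_ *: _); rewrite smash_mapM !smash_map_pure subhopf_val1 mul1r glval1 mulr1.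
by rewrite subhopf_projK ?exprA.
Qed.

End SmashPresentation.

(** * Structure of pointed Hopf algebras of rank one *)

Theorem theorem3p3 (k : fieldType) (p : nat) (char_k : p \in [pchar k])
    (H : hopfType k) (pointed_H : pointed H) (H_neq_H0 : coradical H <> fullv)
    (a : grouplike H) (skew_a : skew_point a)
    (x : H) (Px : x \in skew_primitive (glval a) 1) (x_notin_H0 : x \notin coradical H)
    (q : k) (N : nat) (prim_q : N.-primitive_root q)
    (eigen_x : conj_by a x = q *: x) :
  [/\ (* (1) *)
      forall n : nat, has_degree x n ->
        exists r : nat, n = (N * p ^ r)%N /\
        exists (alpha_m1 : k) (alpha : 'I_r -> k),
          x ^+ n = alpha_m1 *: (glval a ^+ n - 1)
                   + \sum_(i < r) alpha i *: x ^+ (N * p ^ i) /\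
          forall i : 'I_r,
            glval a ^+ (N * (p ^ r - p ^ i)) <> 1 -> alpha i = 0,
      (* (2) *)
      has_rank H 1 -> forall r : nat, has_degree x (N * p ^ r) ->
        (r = 0%N /\ (1 < N)%N) \/ (r = 1%N /\ N = 1%N),
      (* (3) *)
      has_rank H 1 -> forall r : nat, has_degree x (N * p ^ r) ->
        (1 < N)%N -> r = 0%N ->
        exists chi : grouplike H -> k,
          [/\ forall g, chi g <> 0,
              forall g h, chi (g * h)%g = chi g * chi h &
              forall g, conj_by g x = chi g *: x],
      (* (4) *)
      has_rank H 1 -> forall r : nat, has_degree x (N * p ^ r) ->
        N = 1%N -> r = 1%N ->
        (forall y : H, y \in skew_primitive (glval a) 1 -> y \notin coradical H ->
           conj_by a y = 1 *: y) /\
        (forall alpha_m1 alpha_0 : k,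
           x ^+ p = alpha_m1 *: (glval a ^+ p - 1) + alpha_0 *: x ->
           alpha_0 = 0 -> GRing.closed_field_axiom k ->
           exists y : H,
             [/\ y \in skew_primitive (glval a) 1, y \notin coradical H,
                 y ^+ p = 0 &
                 #[a]%g <> p -> common_conj_eigenvector y])
    & (* (5) *)
      has_rank H 1 -> agenv (coradical1 H) = fullv ->
        let A := subhopf_gen [:: glval a; x] in
        exists rho : hopf_action (grouplike H) (subhopf_of A),
          (forall g u, subhopf_val (rho g u) = conj_by g (subhopf_val u)) /\
          exists pi : 'Hom(smash rho, H),
            [/\ forall u g, pi (smash_pure rho u g) = subhopf_val u * glval g,
                is_hopf_hom pi,
                limg pi = fullv &
                lker pi = ideal_gen (smash_pure rho (subhopf_proj A (glval a)) 1%g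
                                     - smash_pure rho 1 a)] ].
Proof.
have q_neq0 := primitive_root_neq0 prim_q.
split=> [n deg_x|rank1 r deg_x|rank1 r _ N_gt1 _|rank1 r _ N1 _|rank1 genH1 A].
- exact: (expr_degree char_k pointed_H Px x_notin_H0 prim_q eigen_x deg_x).
- exact: (rank1_degree char_k pointed_H Px x_notin_H0 prim_q eigen_x rank1 deg_x).
- exact: (conj_character pointed_H Px x_notin_H0 prim_q eigen_x rank1 N_gt1).
- exact: (rank1_eigenvalue1 char_k pointed_H Px x_notin_H0 prim_q eigen_x rank1 N1).
have [n deg_x] := degree_exists x pointed_H.
have aA : glval a \in subhopf_vspace A by apply: mem_subhopf_gen; rewrite !inE eqxx.
have xA : x \in subhopf_vspace A by apply: mem_subhopf_gen; rewrite !inE eqxx orbT.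
have conjA (g : grouplike H) y :
    y \in subhopf_vspace A -> conj_by g y \in subhopf_vspace A.
  apply: conj_by_subhopf_gen => z; rewrite !inE.
  have [ga [c [d [xE _]]]] := conj_skew_rank1 pointed_H Px x_notin_H0 prim_q eigen_x rank1 g.
  case/orP=> /eqP ->; first by rewrite conj_by_glval ga.
  have [A1 _ _ _] := subhopfP A.
  by rewrite xE rpredD ?memvZ // rpredB.
exists (conj_action conjA); split=> [g u|]; first exact: conj_hactE.
exists (smash_map conjA); split.
- exact: smash_map_pure.
- exact: smash_map_hopf.
- have H1x := coradical1_rank1 pointed_H Px x_notin_H0 rank1.
  exact: (limg_smash_map pointed_H conjA xA H1x genH1).
- apply: (lker_smash_map pointed_H Px prim_q eigen_x conjA aA xA deg_x) => y.
  exact: (subhopf_gen_cyclic char_k pointed_H Px x_notin_H0 prim_q eigen_x deg_x).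
Qed.
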